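(* Let $\bar\lambda>0$ be as in the context and assume that $|\lambda_1|,|\lambda_2|\le\bar\lambda$ are sufficiently small so that $1-|\lambda_1|\delta>0$, $\gamma_3-|\gamma_4|\delta>0$ and $1-|\lambda_2|\delta>0$. Assume that the time step satisfies $$\frac{6\,C^2\mathcal D_4}{\nu\varrho}\,\Delta t\le1.$$ Then the sequence $\mathbf v_h^n$ produced by the fully discrete scheme of the context satisfies, for all $1\le n\le N$, $$\|\mathbf v_h^n\|^2_{L^2(\Omega)}+\sum_{i=1}^{n-1}\|\mathbf v_h^i-\mathbf v_h^{i-1}\|^2_{L^2(\Omega)}+\frac\nu\varrho\sum_{i=1}^n\Delta t\,\|\nabla\mathbf v_h^i\|^2_{L^2(\Omega)}+\frac{2\alpha}\varrho\sum_{i=1}^n\Delta t\,\|\mathbf v_h^i\|^2_{L^2(\Omega)}\le C_1\exp(C_2t_n),$$ where $$C_1:=\|\mathbf v_h^0\|^2_{L^2(\Omega)}+\frac{3C^2\mathcal D_3}{\nu\varrho}\|\mathbf u_h^0\|^2_{L^2(\Omega)},\qquad C_2:=\frac{9C^2\mathcal D_4}{\nu\varrho}.$$ If moreover $h^2\le\Delta t$, then these constants are independent of $h$ and $\Delta t$ (i.e. bounded independently of $h$ and $\Delta t$).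
   Context: **Continuous problem.** $\Omega\subset\mathbb R^d$, $d\in\{2,3\}$, is a bounded connected open Lipschitz polytopal domain, $T>0$. Parameters: $\alpha,\nu,\varrho>0$; $E_1>0$, $E_2<0$, $E_1-d|E_2|>0$; $\lambda_1,\lambda_2\in\mathbb R$. $\boldsymbol\varepsilon(\mathbf w)=\frac12(\nabla\mathbf w+(\nabla\mathbf w)^t)$ and $F(f)=E_1(1+\lambda_1f)-d|E_2|(1+\lambda_2f)=\gamma_3+\gamma_4f$. $V=\{\mathbf w\in H^1_0(\Omega)^d:\operatorname{div}\mathbf w=0\}$; $L^2_0(\Omega)$ is the space of mean-zero functions of $L^2(\Omega)$. Initial data $\mathbf u_0\in H^1_0(\Omega)^d$, $\mathbf v_0\in V$. The continuous problem is to find $\mathbf u$, $\mathbf v$ (divergence free), vanishing on $\partial\Omega$, and $p$ (mean zero), with $\mathbf u(0)=\mathbf u_0$, $\mathbf v(0)=\mathbf v_0$ and, for all $\mathbf z,\mathbf w\in H^1_0(\Omega)^d$ and a.e. $t\in]0,T[$, $$\int_\Omega\frac{\boldsymbol\varepsilon(\mathbf u):\boldsymbol\varepsilon(\mathbf z)}{E_1(1+\lambda_1\operatorname{div}\mathbf u)}+\int_\Omega\frac{|E_2|(1+\lambda_2\operatorname{div}\mathbf u)}{E_1(1+\lambda_1\operatorname{div}\mathbf u)}\frac{\operatorname{div}\mathbf u}{F(\operatorname{div}\mathbf u)}\operatorname{div}\mathbf z+\alpha\langle\partial_t\mathbf u,\mathbf z\rangle=\alpha\int_\Omega\mathbf v\cdot\mathbf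 z,$$ $$\langle\varrho\,\partial_t\mathbf v+\nabla p,\mathbf w\rangle+\nu\int_\Omega\nabla\mathbf v:\nabla\mathbf w+\alpha\int_\Omega\mathbf v\cdot\mathbf w=\alpha\langle\partial_t\mathbf u,\mathbf w\rangle.$$ **Standing assumption.** $\bar\lambda>0$ and $D>0$ are such that for all $|\lambda_1|,|\lambda_2|\le\bar\lambda$ the continuous problem has a solution with $\mathbf v,\mathbf u\in L^\infty(0,T;H^2(\Omega)^d)$, $\partial_t\mathbf v,\partial_t\mathbf u\in L^2(0,T;H^1(\Omega)^d)$, $\partial_{tt}^2\mathbf u\in L^2(0,T;H^{-1}(\Omega)^d)$, $p\in L^\infty(0,T;H^1(\Omega))$ and $\|\operatorname{div}\mathbf u\|_{L^\infty(0,T;L^\infty(\Omega))}\le D$. **Truncation.** A number $\delta\ge D$ is fixed, and $T_\delta f=f$ if $|f|\le\delta$, $T_\delta f=\delta\,\mathrm{sign}(f)$ if $|f|>\delta$. **Constants.** $\gamma_1=\frac1{1+|\lambda_1|\delta}$, $\gamma_2=\frac1{1-|\lambda_1|\delta}$, $\gamma_3=E_1+dE_2$, $\gamma_4=E_1\lambda_1+dE_2\lambda_2$, $\gamma_5=\frac1{\gamma_3+|\gamma_4|\delta}$, $\gamma_6=\frac1{\gamma_3-|\gamma_4|\delta}$, $\gamma_7=1-|\lambda_2|\delta$, $\gamma_8=1+|\lambda_2|\delta$. Under the smallness conditions, for all $\mathbf w\in H^1_0(\Omega)^d$: $\gamma_1\le(1+\lambda_1T_\delta\operatorname{div}\mathbf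 w)^{-1}\le\gamma_2$, $\gamma_5\le F(T_\delta\operatorname{div}\mathbf w)^{-1}\le\gamma_6$, $0<\gamma_7\le1+\lambda_2T_\delta\operatorname{div}\mathbf w\le\gamma_8$. $\mathcal P,\mathcal K>0$ are the Poincaré and Korn constants of $\Omega$: $\|\mathbf w\|_{L^2}\le\mathcal P\|\nabla\mathbf w\|_{L^2}$, $\|\nabla\mathbf w\|_{L^2}\le\mathcal K\|\boldsymbol\varepsilon(\mathbf w)\|_{L^2}$ for $\mathbf w\in H^1_0(\Omega)^d$. Further $$\mathcal D_1=\frac{(\gamma_6\gamma_8)^2}{\gamma_5\gamma_7}|E_2|,\quad\mathcal D_2=1+\frac{\mathcal D_1}2,\quad\mathcal D_3=\frac{(\alpha h)^2}{\Delta t}+\frac\alpha{E_1}\frac{\gamma_2^2}{\gamma_1}\mathcal D_2,\quad\mathcal D_4=(\alpha\mathcal P)^2\Big(1+\frac{E_1\mathcal K^2}{\alpha\gamma_1}\mathcal D_3\Big).$$ **Discretization.** $\boldsymbol U_h,\boldsymbol X_h\subset H^1_0(\Omega)^d$ and $Q_h\subset L^2_0(\Omega)$ are finite element spaces with mesh size $h$; there is $\beta^*>0$ independent of $h$ with $\inf_{q\in Q_h}\sup_{\mathbf w\in\boldsymbol X_h}\frac{\int_\Omega q\operatorname{div}\mathbf w}{\|q\|_{L^2}\|\nabla\mathbf w\|_{L^2}}=\beta^*$. $\boldsymbol V_h=\{\mathbf v_h\in\boldsymbol X_h:\int_\Omega q_h\operatorname{div}\mathbf v_h=0\ \forall q_h\in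 Q_h\}$. $\Pi_h$ denotes interpolation operators $H^1_0(\Omega)^d\to\boldsymbol U_h$, $H^1_0(\Omega)^d\to\boldsymbol X_h$ and $V\to\boldsymbol V_h$ (same symbol), satisfying, with $C>0$ independent of $h$, $\|\nabla\Pi_h\mathbf w\|_{L^2}\le C\|\nabla\mathbf w\|_{L^2}$ and $\|\mathbf w-\Pi_h\mathbf w\|_{L^2}\le Ch\|\nabla\mathbf w\|_{L^2}$; this is the constant $C$ of the claim. **Fully discrete scheme.** $N>1$, $\Delta t=T/N$, $t_n=n\Delta t$; $\mathbf u_h^0=\Pi_h\mathbf u_0\in\boldsymbol U_h$, $\mathbf v_h^0=\Pi_h\mathbf v_0\in\boldsymbol V_h$. For $1\le n\le N$, given $\mathbf u_h^{n-1}\in\boldsymbol U_h$, $\mathbf v_h^{n-1}\in\boldsymbol V_h$, find $\mathbf u_h^n\in\boldsymbol U_h$, $\mathbf v_h^n\in\boldsymbol V_h$, $p_h^n\in Q_h$ such that for all $\mathbf z_h\in\boldsymbol U_h$, $\mathbf w_h\in\boldsymbol X_h$, $$\frac{\alpha}{\Delta t}\int_\Omega(\mathbf u_h^n-\mathbf u_h^{n-1})\cdot\mathbf z_h+\frac1{E_1}\int_\Omega\frac{\boldsymbol\varepsilon(\mathbf u_h^n):\boldsymbol\varepsilon(\mathbf z_h)}{1+\lambda_1T_\delta\operatorname{div}\mathbf u_h^{n-1}}+\frac{|E_2|}{E_1}\int_\Omega\frac{1+\lambda_2T_\delta\operatorname{div}\mathbf u_h^{n-1}}{1+\lambda_1T_\delta\operatorname{div}\mathbf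 u_h^{n-1}}\frac{(\operatorname{div}\mathbf u_h^n)(\operatorname{div}\mathbf z_h)}{F(T_\delta\operatorname{div}\mathbf u_h^{n-1})}=\alpha\int_\Omega\mathbf v_h^n\cdot\mathbf z_h,$$ $$\frac{\varrho}{\Delta t}\int_\Omega(\mathbf v_h^n-\mathbf v_h^{n-1})\cdot\mathbf w_h-\int_\Omega p_h^n\operatorname{div}\mathbf w_h+\nu\int_\Omega\nabla\mathbf v_h^n:\nabla\mathbf w_h+\alpha\int_\Omega\mathbf v_h^n\cdot\mathbf w_h=\frac{\alpha}{\Delta t}\int_\Omega(\mathbf u_h^n-\mathbf u_h^{n-1})\cdot\mathbf w_h.$$ *)

(* Defs.v *)
From HB Require Import structures.
From mathcomp Require Import all_boot all_order all_algebra.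
From mathcomp Require Import all_classical all_reals all_analysis.
Set Implicit Arguments.
Unset Strict Implicit.
Unset Printing Implicit Defensive.
Import Order.TTheory GRing.Theory Num.Theory.
Import numFieldNormedType.Exports.
Local Open Scope classical_set_scope.
Local Open Scope ring_scope.

(* Borel sigma-algebra; for m = 1 the Borel sets of R^n. *)
HB.instance Definition _ (R : realType) (m n : nat) :=
  @isMeasurable.Build (sigma_display (@open 'M[R]_(m, n)))
    'M[R]_(m, n) (<<s @open 'M[R]_(m, n) >>)
    (@sigma_algebra0 _ _ _) (@sigma_algebraC _ _) (@sigma_algebra_bigcup _ _ _).

Section lebesgue_rV.
Variable R : realType.

Definition cons_rV (n : nat) (p : R * 'rV[R]_n) : 'rV[R]_n.+1 :=
  row_mx (p.1%:M : 'rV[R]_1) p.2.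

Lemma continuous_measurable_mx m n k l (f : 'M[R]_(m,n) -> 'M[R]_(k,l)) :
  continuous f -> measurable_fun setT f.
Proof.
move=> /continuousP cf; apply: (measurability (@open 'M[R]_(k, l))) => //.
move=> _ [B oB <-]; rewrite setTI.
by apply: sub_sigma_algebra; exact: cf.
Qed.

Lemma continuous_measurable_mxR m n (f : 'M[R]_(m,n) -> R) :
  continuous f -> measurable_fun setT f.
Proof.
move=> /continuousP cf; apply: (measurability _ (measurable_realfun.RGenOpens.measurableE R)).
move=> _ [_ [a [b ->]] <-]; rewrite setTI.
apply: sub_sigma_algebra; exact/cf/interval_open.
Qed.

Lemma rV_rat_dense n (x : 'rV[R]_n) (e : R) : 0 < e ->
  exists q : 'rV[rat]_n, ball (map_mx (ratr : rat -> R) q) e x.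
Proof.
move=> e0.
have H (i : 'I_n) : {q : rat | ball (ratr q : R) e (x ord0 i)}.
  apply/cid.
  have : x ord0 i - e < x ord0 i + e by rewrite ltrBlDr -addrA ltrDl addr_gt0.
  move=> /rat_in_itvoo[q]; rewrite in_itv/= => /andP[q1 q2]; exists q.
  by rewrite /ball/= ltr_distl q1 q2.
exists (\row_i sval (H i)); split => // i j; rewrite (ord1 i) !mxE.
exact: (svalP (H j)).
Qed.

Lemma measurable_cons_rV n : measurable_fun setT (@cons_rV n).
Proof.
apply: (measurability (@open 'rV[R]_n.+1)) => //.
move=> _ [B oB <-]; rewrite setTI.
pose A (k : rat * 'rV[rat]_n * nat) : set (R * 'rV[R]_n) :=
  ball (ratr k.1.1 : R) k.2.+1%:R^-1 `*`
  ball (map_mx (ratr : rat -> R) k.1.2) k.2.+1%:R^-1.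
rewrite (_ : _ @^-1` _ = \bigcup_(k in [set k | A k `<=` @cons_rV n @^-1` B]) A k).
  rewrite bigcup_mkcond; apply: countable_bigcupT_measurable.
    exact: countableP.
  move=> k; case: ifP => // _.
  apply: measurableX; first exact: measurable_realfun.measurable_ball.
  apply: sub_sigma_algebra; exact: ball_open.
apply/seteqP; split=> [[t y] /= By|[t y] [k /= kB kA]]; last exact: kB.
have /nbhs_ballP[e /= e0 eB] := open_nbhs_nbhs (conj oB By).
have [N Ne] : exists N : nat, N.+1%:R^-1 < e / 2.
  have e2 : 0 < e / 2 by rewrite divr_gt0.
  by have [N _ /(_ N (leqnn _))/= h] := near_infty_natSinv_lt (PosNum e2); exists N.
have N0 : 0 < (N.+1%:R : R)^-1 by rewrite invr_gt0.
have : t - N.+1%:R^-1 < t + N.+1%:R^-1 by rewrite ltrBlDr -addrA ltrDl addr_gt0.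
move=> /rat_in_itvoo[q]; rewrite in_itv/= => /andP[q1 q2].
have [w ww] := rV_rat_dense y N0.
exists (q, w, N) => /=; last first.
  split => //=.
  by rewrite /ball/= ltr_distl q1 q2.
have dd a b c : `|(a:R) - b| < N.+1%:R^-1 -> `|a - c| < N.+1%:R^-1 -> `|b - c| < e.
  move=> h1 h2; rewrite (splitr e) -(subrKA a) (le_lt_trans (ler_normD _ _))//.
  by rewrite ltrD// (lt_trans _ Ne)// distrC.
move=> [s z] [/= sq zw]; apply: eB; split => // i j; rewrite /cons_rV !mxE/= /ball/=.
case: splitP => k jk; rewrite ?mxE.
  rewrite ?ord1 !mulr1n; apply: (@dd (ratr q)) => //.
  by rewrite ltr_distl q1 q2.
rewrite ord1; apply: (@dd (map_mx ratr w ord0 k)).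
  exact: ww.2.
exact: zw.2.
Qed.

Lemma measurable_coord m n (i : 'I_m) (j : 'I_n) :
  measurable_fun setT (fun x : 'M[R]_(m, n) => x i j).
Proof. by apply: continuous_measurable_mxR; exact: coord_continuous. Qed.


Lemma continuous_rsubmx n :
  continuous (rsubmx : 'rV[R]_(1 + n) -> 'rV[R]_n).
Proof.
move=> x s /= /nbhs_ballP[e e0 es]; apply/nbhs_ballP; exists e => //= y [_ xy].
by apply: es; split => // i j; rewrite !mxE; exact: xy.
Qed.

Section step.
Variables (n : nat) (m : {sigma_finite_measure set 'rV[R]_n -> \bar R}).

Definition lebesgue_cons : set 'rV[R]_n.+1 -> \bar R :=
  pushforward (lebesgue_measure \x m)%E (@cons_rV n).

Let lebesgue_cons0 : lebesgue_cons set0 = 0%E.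
Proof. by rewrite /lebesgue_cons /pushforward preimage_set0 measure0. Qed.

Let lebesgue_cons_ge0 A : (0 <= lebesgue_cons A)%E.
Proof.
by rewrite /lebesgue_cons /pushforward; exact: (measure_ge0 (lebesgue_measure \x m)%E).
Qed.

Let lebesgue_cons_sigma_additive : semi_sigma_additive lebesgue_cons.
Proof.
exact: (@measure_semi_sigma_additive _ _ _
  (measure_function_pushforward__canonical__measure_function_Measure
     (lebesgue_measure \x m)%E (@measurable_cons_rV n))).
Qed.

HB.instance Definition _ := isMeasure.Build _ _ _ lebesgue_cons
  lebesgue_cons0 lebesgue_cons_ge0 lebesgue_cons_sigma_additive.

Let lebesgue_cons_sigma_finite : sigma_finite setT lebesgue_cons.
Proof.
have /sigma_finiteP[F [UF ndF Foo]] := sigma_finiteT (@lebesgue_measure R).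
have /sigma_finiteP[G [UG ndG Goo]] := sigma_finiteT m.
pose g (x : 'rV[R]_n.+1) : R * 'rV[R]_n := (x ord0 ord0, rsubmx (x : 'rV_(1 + n))).
have mg : measurable_fun setT g.
  apply: measurable_fun_pair; first exact: measurable_coord.
  exact: (continuous_measurable_mx (@continuous_rsubmx n)).
have gK : cancel (@cons_rV n) g.
  move=> [t y]; rewrite /g /cons_rV row_mxKr; congr pair.
  by rewrite mxE; case: splitP => j; rewrite ?mxE ?ord1 ?eqxx ?mulr1n.
exists (fun k => g @^-1` (F k `*` G k)).
  apply/esym/seteqP; split=> // x _.
  have [k _ Fk] : (\bigcup_k F k) (g x).1 by rewrite -UF.
  have [l _ Gl] : (\bigcup_k G k) (g x).2 by rewrite -UG.
  exists (maxn k l) => //; split.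
    exact: (subsetPset _ _ (ndF _ _ (leq_maxl k l))).
  exact: (subsetPset _ _ (ndG _ _ (leq_maxr k l))).
move=> k; have [mF Fk] := Foo k; have [mG Gk] := Goo k; split.
  by rewrite -[X in measurable X]setTI; apply: mg => //; exact: measurableX.
rewrite /lebesgue_cons /pushforward -comp_preimage.
rewrite (_ : g \o _ = id); last by rewrite funeqE; exact: gK.
by rewrite preimage_id product_measure1E// lte_mul_pinfty// ge0_fin_numE.
Qed.

HB.instance Definition _ := Measure_isSigmaFinite.Build _ _ _ lebesgue_cons
  lebesgue_cons_sigma_finite.
End step.

(* Lebesgue measure on R^n, by iterated products with the one-dimensional one. *)
Fixpoint lebesgue_rV (n : nat) : {sigma_finite_measure set 'rV[R]_n -> \bar R} :=
  if n is n'.+1 then lebesgue_cons (lebesgue_rV n') else \d_(0 : 'rV[R]_0).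
End lebesgue_rV.
Arguments lebesgue_rV : clear implicits.

Section Domain.
Variables (R : realType) (d : nat).
Local Notation point := 'rV[R]_d.

(* Euclidean inner product of vectors, Frobenius product of matrices. *)
Definition frob m n (A B : 'M[R]_(m, n)) : R :=
  \sum_i \sum_j A i j * B i j.

Definition convex_hull (s : seq point) : set point :=
  [set x | exists c : 'I_(size s) -> R,
    [/\ forall i, 0 <= c i, \sum_i c i = 1 & x = \sum_i c i *: s`_i]].

(* Near each boundary point, the domain is the part of the space above the
   graph of a Lipschitz function over the hyperplane orthogonal to some unit
   vector e; y - frob y e *: e is the orthogonal projection of y. *)
Definition lipschitz_boundary (Omega : set point) : Prop :=
  forall x, (closure Omega `\` Omega) x ->
  exists (e : point) (g : point -> R) (L r : R),
    [/\ frob e e = 1, 0 < r,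
        forall y z, `|g y - g z| <= L * `|y - z| &
        forall y, ball x r y ->
          (Omega y <-> g (y - frob y e *: e) < frob y e)].

Definition polytopal (Omega : set point) : Prop :=
  exists ps : seq (seq point),
    closure Omega = \bigcup_(s in [set` ps]) convex_hull s.

Definition lipschitz_polytopal_domain (Omega : set point) : Prop :=
  [/\ Omega !=set0, open Omega & connected Omega] /\
  [/\ bounded_set Omega, lipschitz_boundary Omega & polytopal Omega].

End Domain.

(* Elements of Lebesgue and Sobolev spaces are represented by functions defined
   everywhere on R^d, of which only the almost everywhere class of the
   restriction to Omega matters. *)
Section Sobolev.
Variables (R : realType) (d : nat) (Omega : set 'rV[R]_d).
Local Notation point := 'rV[R]_d.
Local Notation mu := (lebesgue_rV R d).
Local Notation sfield := (point -> R).
Local Notation vfield := (point -> 'rV[R]_d).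
Local Notation "'e_ i" := (delta_mx ord0 i : point) (at level 8, i at level 2).

Definition smooth (f : sfield) : Prop :=
  forall s : seq 'I_d,
    let g := foldr (fun i g => 'D_('e_i) g) f s in
    continuous g /\ forall i x, derivable g x 'e_i.

Definition test_function (phi : sfield) : Prop :=
  smooth phi /\
  exists K, [/\ compact K, K `<=` Omega & forall x, ~ K x -> phi x = 0].

Definition is_weak_derivative (i : 'I_d) (f g : sfield) : Prop :=
  [/\ forall K, compact K -> K `<=` Omega -> mu.-integrable K (EFin \o f),
      forall K, compact K -> K `<=` Omega -> mu.-integrable K (EFin \o g) &
      forall phi, test_function phi ->
        \int[mu]_(x in Omega) (f x * 'D_('e_i) phi x) =
        - \int[mu]_(x in Omega) (g x * phi x)].

(* A version of the weak derivative, if there is one. *)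
Definition wderiv (i : 'I_d) (f : sfield) : sfield :=
  xget (fun=> 0) [set g | is_weak_derivative i f g].

Definition inL2 (f : sfield) : Prop :=
  measurable_fun Omega f /\ (\int[mu]_(x in Omega) ((f x ^+ 2)%:E) < +oo)%E.

Definition inL2_0 (f : sfield) : Prop :=
  inL2 f /\ \int[mu]_(x in Omega) f x = 0.

Definition inH1 (f : sfield) : Prop :=
  inL2 f /\
  forall i, (exists g, is_weak_derivative i f g) /\ inL2 (wderiv i f).

Definition inH2 (f : sfield) : Prop :=
  inH1 f /\ forall i, inH1 (wderiv i f).

(* Closure of the test functions in H^1. *)
Definition inH10 (f : sfield) : Prop :=
  inH1 f /\
  exists phi : nat -> sfield,
    [/\ forall k, test_function (phi k),
        (\int[mu]_(x in Omega) (((f x - phi k x) ^+ 2)%:E))%E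
          @[k --> \oo] --> 0%E &
        forall i,
        (\int[mu]_(x in Omega) (((wderiv i f x - 'D_('e_i) (phi k) x) ^+ 2)%:E))%E
          @[k --> \oo] --> 0%E].

Definition L2sq (f : sfield) : R := \int[mu]_(x in Omega) (f x ^+ 2).
Definition H1sq (f : sfield) : R := L2sq f + \sum_i L2sq (wderiv i f).
Definition H2sq (f : sfield) : R := L2sq f + \sum_i H1sq (wderiv i f).

Definition component (w : vfield) (i : 'I_d) : sfield := fun x => w x ord0 i.

Definition inL2v (w : vfield) : Prop := forall i, inL2 (component w i).
Definition inH10v (w : vfield) : Prop := forall i, inH10 (component w i).

Definition grad (w : vfield) (x : point) : 'M[R]_d :=
  \matrix_(i, j) wderiv j (component w i) x.

Definition symgrad (w : vfield) (x : point) : 'M[R]_d :=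
  2^-1 *: (grad w x + (grad w x)^T).

Definition div (w : vfield) : sfield := fun x => \tr (grad w x).

Definition inV (w : vfield) : Prop :=
  inH10v w /\ {ae mu, forall x, Omega x -> div w x = 0}.

Definition L2dot m n (A B : point -> 'M[R]_(m, n)) : R :=
  \int[mu]_(x in Omega) frob (A x) (B x).

Definition L2norm m n (A : point -> 'M[R]_(m, n)) : R := Num.sqrt (L2dot A A).

Definition poincare_constant (P : R) : Prop :=
  forall w, inH10v w -> L2norm w <= P * L2norm (grad w).

Definition korn_constant (K : R) : Prop :=
  forall w, inH10v w -> L2norm (grad w) <= K * L2norm (symgrad w).

End Sobolev.

Record material (R : realType) :=
  Material { alpha : R; nu : R; rho : R; E1 : R; E2 : R }.

Definition admissible_material (R : realType) (d : nat) (m : material R) : Prop :=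
  [/\ 0 < alpha m, 0 < nu m & 0 < rho m] /\
  [/\ 0 < E1 m, E2 m < 0 & 0 < E1 m - d%:R * `|E2 m|].

Definition Flin (R : realType) (d : nat) (m : material R) (l1 l2 f : R) : R :=
  E1 m * (1 + l1 * f) - d%:R * `|E2 m| * (1 + l2 * f).

Section Continuous_problem.
Variables (R : realType) (d : nat) (Omega : set 'rV[R]_d) (T : R).
Local Notation point := 'rV[R]_d.
Local Notation mu := (lebesgue_rV R d).
Local Notation leb := (@lebesgue_measure R).
Local Notation sfield := (point -> R).
Local Notation vfield := (point -> 'rV[R]_d).
Local Notation grad := (grad Omega).
Local Notation symgrad := (symgrad Omega).
Local Notation div := (div Omega).
Local Notation inH10v := (inH10v Omega).
Local Notation L2dot := (L2dot Omega).

(* Weak measurability into L^2; since L^2 is separable, this is strong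
   measurability, and for functions with values in H^1 or H^2 it is strong
   measurability into these spaces. *)
Definition time_measurable (f : R -> sfield) : Prop :=
  forall z, inL2 Omega z ->
    measurable_fun `]0, T[ (fun t => \int[mu]_(x in Omega) (f t x * z x)).

(* Bochner spaces L^oo(0, T; X) and L^2(0, T; X), where X is given by its
   membership predicate and its squared norm. *)
Definition inLinfty_time (inX : sfield -> Prop) (sqX : sfield -> R)
    (f : R -> sfield) : Prop :=
  time_measurable f /\
  exists M, {ae leb, forall t, t \in `]0, T[ -> inX (f t) /\ sqX (f t) <= M}.

Definition inL2_time (inX : sfield -> Prop) (sqX : sfield -> R)
    (f : R -> sfield) : Prop :=
  [/\ time_measurable f,
      {ae leb, forall t, t \in `]0, T[ -> inX (f t)} &
      leb.-integrable `]0, T[ (fun t => (sqX (f t))%:E)].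

Definition time_comp (w : R -> vfield) (i : 'I_d) : R -> sfield :=
  fun t => component (w t) i.

Definition time_test_function (eta : R -> R) : Prop :=
  (forall k t, derivable (derive1n k eta) t 1) /\
  exists a b, [/\ 0 < a, b < T & forall t, t \notin `[a, b] -> eta t = 0].

Definition is_time_weak_derivative (f g : R -> R) : Prop :=
  [/\ leb.-integrable `]0, T[ (EFin \o f),
      leb.-integrable `]0, T[ (EFin \o g) &
      forall eta, time_test_function eta ->
        \int[leb]_(t in `]0, T[) (f t * derive1 eta t) =
        - \int[leb]_(t in `]0, T[) (g t * eta t)].

Definition is_time_derivative (w wt : R -> vfield) : Prop :=
  forall z, inL2v Omega z ->
    is_time_weak_derivative (fun t => L2dot (w t) z) (fun t => L2dot (wt t) z).

(* G represents an element of L^2(0, T; H^{-1}), H^{-1} being the dual of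
   H^1_0; m t bounds the norm of the functional G t. *)
Definition inL2_Hm1 (G : R -> vfield -> R) : Prop :=
  (forall z, inH10v z -> measurable_fun `]0, T[ (fun t => G t z)) /\
  exists m : R -> R,
    leb.-integrable `]0, T[ (fun t => (m t ^+ 2)%:E) /\
    {ae leb, forall t, t \in `]0, T[ ->
      (forall c z z', inH10v z -> inH10v z' ->
         G t (fun x => c *: z x + z' x) = c * G t z + G t z') /\
      (forall z, inH10v z ->
         `|G t z| <= m t * Num.sqrt (\sum_i H1sq Omega (component z i)))}.

Definition is_time_derivative_Hm1 (w : R -> vfield) (G : R -> vfield -> R) : Prop :=
  forall z, inH10v z ->
    is_time_weak_derivative (fun t => L2dot (w t) z) (fun t => G t z).

(* u, v, p solve the continuous problem with time derivatives ut, vt, utt and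
   have the assumed regularity, with D bounding div u. Given that regularity,
   the duality brackets of ut and vt are L^2 products. *)
Record regular_solution (m : material R) (l1 l2 : R) (u0 v0 : vfield) (D : R)
    (u v ut vt : R -> vfield) (utt : R -> vfield -> R) (p : R -> sfield) : Prop :=
  RegularSolution {
  sol_u_H10 : {ae leb, forall t, t \in `]0, T[ -> inH10v (u t)} ;
  sol_v_V : {ae leb, forall t, t \in `]0, T[ -> inV Omega (v t)} ;
  sol_p_L20 : {ae leb, forall t, t \in `]0, T[ -> inL2_0 Omega (p t)} ;
  sol_u_Linfty_H2 : forall i,
    inLinfty_time (inH2 Omega) (H2sq Omega) (time_comp u i) ;
  sol_v_Linfty_H2 : forall i,
    inLinfty_time (inH2 Omega) (H2sq Omega) (time_comp v i) ;
  sol_p_Linfty_H1 : inLinfty_time (inH1 Omega) (H1sq Omega) p ;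
  sol_ut : is_time_derivative u ut ;
  sol_vt : is_time_derivative v vt ;
  sol_utt : is_time_derivative_Hm1 ut utt ;
  sol_ut_L2_H1 : forall i,
    inL2_time (inH1 Omega) (H1sq Omega) (time_comp ut i) ;
  sol_vt_L2_H1 : forall i,
    inL2_time (inH1 Omega) (H1sq Omega) (time_comp vt i) ;
  sol_utt_L2_Hm1 : inL2_Hm1 utt ;
  sol_u_init : L2norm Omega (fun x => u t x - u0 x) @[t --> 0^'+] --> (0 : R) ;
  sol_v_init : L2norm Omega (fun x => v t x - v0 x) @[t --> 0^'+] --> (0 : R) ;
  sol_div_bound : {ae leb, forall t, t \in `]0, T[ ->
    {ae mu, forall x, Omega x -> `|div (u t) x| <= D}} ;
  sol_denominators : {ae leb, forall t, t \in `]0, T[ ->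
    {ae mu, forall x, Omega x ->
      1 + l1 * div (u t) x != 0 /\ Flin d m l1 l2 (div (u t) x) != 0}} ;
  sol_elasticity : forall z, inH10v z -> {ae leb, forall t, t \in `]0, T[ ->
    let stress := fun x =>
      frob (symgrad (u t) x) (symgrad z x) / (E1 m * (1 + l1 * div (u t) x)) in
    let pressure := fun x =>
      `|E2 m| * (1 + l2 * div (u t) x) / (E1 m * (1 + l1 * div (u t) x)) *
      (div (u t) x / Flin d m l1 l2 (div (u t) x)) * div z x in
    [/\ mu.-integrable Omega (EFin \o stress),
        mu.-integrable Omega (EFin \o pressure) &
        \int[mu]_(x in Omega) stress x + \int[mu]_(x in Omega) pressure x +
          alpha m * L2dot (ut t) z = alpha m * L2dot (v t) z]} ;
  sol_flow : forall w, inH10v w -> {ae leb, forall t, t \in `]0, T[ ->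
    rho m * L2dot (vt t) w - \int[mu]_(x in Omega) (p t x * div w x) +
      nu m * L2dot (grad (v t)) (grad w) + alpha m * L2dot (v t) w =
    alpha m * L2dot (ut t) w}
  }.

Definition has_regular_solution (m : material R) (l1 l2 : R)
    (u0 v0 : vfield) (D : R) : Prop :=
  exists u v ut vt utt p,
    regular_solution m l1 l2 u0 v0 D u v ut vt utt p.

End Continuous_problem.

Section Constants.
Variables (R : realType) (d : nat) (m : material R) (l1 l2 delta : R).

Definition truncation (f : R) : R :=
  if `|f| <= delta then f else delta * Num.sg f.

Definition gamma1 : R := (1 + `|l1| * delta)^-1.
Definition gamma2 : R := (1 - `|l1| * delta)^-1.
Definition gamma3 : R := E1 m + d%:R * E2 m.
Definition gamma4 : R := E1 m * l1 + d%:R * E2 m * l2.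
Definition gamma5 : R := (gamma3 + `|gamma4| * delta)^-1.
Definition gamma6 : R := (gamma3 - `|gamma4| * delta)^-1.
Definition gamma7 : R := 1 - `|l2| * delta.
Definition gamma8 : R := 1 + `|l2| * delta.

Definition D1 : R := (gamma6 * gamma8) ^+ 2 / (gamma5 * gamma7) * `|E2 m|.
Definition D2 : R := 1 + D1 / 2.
Definition D3 (h dt : R) : R :=
  (alpha m * h) ^+ 2 / dt + alpha m / E1 m * (gamma2 ^+ 2 / gamma1) * D2.
Definition D4 (P K h dt : R) : R :=
  (alpha m * P) ^+ 2 * (1 + E1 m * K ^+ 2 / (alpha m * gamma1) * D3 h dt).

End Constants.

Section Discretization.
Variables (R : realType) (d : nat) (Omega : set 'rV[R]_d).
Local Notation point := 'rV[R]_d.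
Local Notation mu := (lebesgue_rV R d).
Local Notation sfield := (point -> R).
Local Notation vfield := (point -> 'rV[R]_d).
Local Notation grad := (grad Omega).
Local Notation symgrad := (symgrad Omega).
Local Notation div := (div Omega).
Local Notation inH10v := (inH10v Omega).
Local Notation L2dot := (L2dot Omega).
Local Notation L2norm := (L2norm Omega).

(* A cell is given by a finite set of points spanning it; the mesh size is the
   largest Euclidean diameter of a cell. *)
Definition is_mesh (h : R) (cells : seq (seq point)) : Prop :=
  [/\ forall s, s \in cells -> (convex_hull s)° !=set0,
      forall i j, (i < j < size cells)%N ->
        (convex_hull (nth [::] cells i))° `&`
        (convex_hull (nth [::] cells j))° = set0,
      \bigcup_(s in [set` cells]) convex_hull s = closure Omega,
      forall s x y, s \in cells -> convex_hull s x -> convex_hull s y ->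
        Num.sqrt (frob (x - y) (x - y)) <= h &
      exists s x y, [/\ s \in cells, convex_hull s x, convex_hull s y &
        Num.sqrt (frob (x - y) (x - y)) = h]].

Definition polynomial_function (f : sfield) : Prop :=
  exists s : seq (R * ('I_d -> nat)),
    forall x, f x = \sum_(m <- s) m.1 * \prod_i x ord0 i ^+ m.2 i.

Definition piecewise_polynomial (cells : seq (seq point)) (f : sfield) : Prop :=
  forall s, s \in cells -> exists g, polynomial_function g /\
    {ae mu, forall x, (convex_hull s)° x -> f x = g x}.

Definition finite_dim_subspace (W : lmodType R) (S : set (point -> W)) : Prop :=
  [/\ S (fun=> 0),
      forall c f g, S f -> S g -> S (fun x => c *: f x + g x) &
      exists (k : nat) (b : 'I_k -> point -> W), forall f, S f ->
        exists c : 'I_k -> R,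
          {ae mu, forall x, Omega x -> f x = \sum_i c i *: b i x}].

Definition scalar_fe_space (h : R) (S : set sfield) : Prop :=
  finite_dim_subspace (W := R^o) S /\
  exists cells, is_mesh h cells /\
    forall f, S f -> piecewise_polynomial cells f.

Definition vector_fe_space (h : R) (S : set vfield) : Prop :=
  finite_dim_subspace S /\
  exists cells, is_mesh h cells /\
    forall w, S w -> forall i, piecewise_polynomial cells (component w i).

(* piU, piX and piV are the three interpolation operators denoted by Pi_h. *)
Record discretization := Discretization {
  Uh : set vfield ;
  Xh : set vfield ;
  Qh : set sfield ;
  piU : vfield -> vfield ;
  piX : vfield -> vfield ;
  piV : vfield -> vfield }.

Definition Vh (S : discretization) : set vfield :=
  [set w | Xh S w /\
    forall q, Qh S q -> \int[mu]_(x in Omega) (q x * div w x) = 0].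

Definition inf_sup_constant (S : discretization) (beta : R) : Prop :=
  ereal_inf [set ereal_sup
      [set ((\int[mu]_(x in Omega) (q x * div w x)) /
            (Num.sqrt (L2sq Omega q) * L2norm (grad w)))%:E
        | w in [set w | Xh S w /\ L2norm (grad w) != 0]]
    | q in [set q | Qh S q /\ L2sq Omega q != 0]] = beta%:E.

Definition interpolation_bounds (C h : R) (w piw : vfield) : Prop :=
  L2norm (grad piw) <= C * L2norm (grad w) /\
  L2norm (fun x => w x - piw x) <= C * h * L2norm (grad w).

Record admissible_discretization (C beta h : R) (S : discretization) : Prop :=
  AdmissibleDiscretization {
  Uh_H10 : Uh S `<=` [set w | inH10v w] ;
  Xh_H10 : Xh S `<=` [set w | inH10v w] ;
  Qh_L20 : Qh S `<=` [set q | inL2_0 Omega q] ;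
  Uh_fe : vector_fe_space h (Uh S) ;
  Xh_fe : vector_fe_space h (Xh S) ;
  Qh_fe : scalar_fe_space h (Qh S) ;
  inf_sup : inf_sup_constant S beta ;
  piU_spec : forall w, inH10v w ->
    Uh S (piU S w) /\ interpolation_bounds C h w (piU S w) ;
  piX_spec : forall w, inH10v w ->
    Xh S (piX S w) /\ interpolation_bounds C h w (piX S w) ;
  piV_spec : forall w, inV Omega w ->
    Vh S (piV S w) /\ interpolation_bounds C h w (piV S w)
  }.

Record scheme_solution (m : material R) (l1 l2 delta T : R) (u0 v0 : vfield)
    (S : discretization) (N : nat) (u v : nat -> vfield) (p : nat -> sfield) : Prop :=
  SchemeSolution {
  scheme_u0 : u 0%N = piU S u0 ;
  scheme_v0 : v 0%N = piV S v0 ;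
  scheme_spaces : forall n, (1 <= n <= N)%N ->
    [/\ Uh S (u n), Vh S (v n) & Qh S (p n)] ;
  scheme_elasticity : forall n z, (1 <= n <= N)%N -> Uh S z ->
    let dt := T / N%:R in
    let tau := fun x => truncation delta (div (u n.-1) x) in
    alpha m / dt * L2dot (fun x => u n x - u n.-1 x) z +
    (E1 m)^-1 * \int[mu]_(x in Omega)
      (frob (symgrad (u n) x) (symgrad z x) / (1 + l1 * tau x)) +
    `|E2 m| / E1 m * \int[mu]_(x in Omega)
      ((1 + l2 * tau x) / (1 + l1 * tau x) *
       (div (u n) x * div z x / Flin d m l1 l2 (tau x))) =
    alpha m * L2dot (v n) z ;
  scheme_flow : forall n w, (1 <= n <= N)%N -> Xh S w ->
    let dt := T / N%:R in
    rho m / dt * L2dot (fun x => v n x - v n.-1 x) w -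
    \int[mu]_(x in Omega) (p n x * div w x) +
    nu m * L2dot (grad (v n)) (grad w) + alpha m * L2dot (v n) w =
    alpha m / dt * L2dot (fun x => u n x - u n.-1 x) w
  }.

End Discretization.

(* Main.v *)
(* Test the flow equation with v_n, which removes the pressure, and replace v_n in
   the coupling term by its interpolant Pi v_n in U_h, up to the interpolation error;
   the elasticity equation tested with Pi v_n then evaluates the coupling.  Three
   Young inequalities absorb half of the viscous term, and leave multiples of
   ||u_n - u_(n-1)||^2, of ||v_n||^2 and of the elastic energy of u_n.  The first
   and the last are at most D3 times quantities which the elasticity equation tested
   with u_n controls by ||v_n||^2; this gives the factor D4 and a discrete
   Gronwall inequality.

   Obtaining D1 with no factor d requires ||div z|| <= ||grad z|| on H^1_0, i.e.
   one integration by parts: d_i(psi) is itself a test function, so the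
   definition of weak derivatives, the symmetry of second derivatives of psi and the
   density of test functions suffice, without any trace or Fubini argument. *)
Require Import Defs.
From HB Require Import structures.
From mathcomp Require Import all_boot all_order all_algebra.
From mathcomp Require Import all_classical all_reals all_analysis measurable_realfun.
From mathcomp Require Import ring lra.
Import Order.TTheory GRing.Theory Num.Theory.
Import numFieldNormedType.Exports.
Local Open Scope classical_set_scope.
Local Open Scope ring_scope.

(** * Symmetry of mixed second derivatives *)

Section MixedDerivatives.
Context {R : realType} {V : normedModType R}.
Implicit Types (f : V -> R) (x v w : V).

Lemma is_derive_line f x v (t : R) : derivable f (x + t *: v) v ->
  is_derive t 1 (fun s : R => f (x + s *: v)) ('D_v f (x + t *: v)).
Proof.
move=> df.
have E : (fun h : R => h^-1 *: (((fun s : R => f (x + s *: v)) \o shift t) (h *: (1 : R)) -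
    f (x + t *: v))) =
    (fun h => h^-1 *: ((f \o shift (x + t *: v)) (h *: v) - f (x + t *: v))).
  apply/funext => h /=; congr (_ *: (f _ - _)).
  by rewrite scalerDl scaler1 addrCA.
split; first by rewrite /derivable E.
by rewrite /derive E.
Qed.

(** The mean value theorem is applied twice: along [v] to the increment of [f] under the shift by
    [h *: w], then along [w] to ['D_v f]. *)
Lemma second_difference f v w x (h : R) : 0 < h ->
  (forall y, derivable f y v) -> (forall y, derivable ('D_v f) y w) ->
  exists s t, [/\ 0 < s < h, 0 < t < h &
    f (x + h *: v + h *: w) - f (x + h *: v) - (f (x + h *: w) - f x) =
    'D_w ('D_v f) (x + s *: v + t *: w) * h ^+ 2].
Proof.
move=> h0 dv dw.
have lineD y (s : R) : is_derive s 1 (fun s : R => f (y + s *: v)) ('D_v f (y + s *: v)).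
  exact: is_derive_line.
pose g (s : R) := f (x + h *: w + s *: v) - f (x + s *: v).
have gD (s : R) : is_derive s 1 g ('D_v f (x + h *: w + s *: v) - 'D_v f (x + s *: v)).
  by have ? := lineD (x + h *: w) s; have ? := lineD x s; exact: is_deriveB.
have gc : {within `[0, h], continuous g}.
  by apply: derivable_within_continuous => s _; have [] := gD s.
have [s + gE] := MVT h0 (fun s _ => gD s) gc.
rewrite in_itv/= => sh.
have kD (t : R) : is_derive t 1 (fun t : R => 'D_v f (x + s *: v + t *: w))
    ('D_w ('D_v f) (x + s *: v + t *: w)) by exact: is_derive_line.
have kc : {within `[0, h], continuous (fun t : R => 'D_v f (x + s *: v + t *: w))}.
  by apply: derivable_within_continuous => t _; have [] := kD t.
have [t + kE] := MVT h0 (fun t _ => kD t) kc.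
rewrite in_itv/= => th.
exists s, t; split => //.
move: gE kE; rewrite /g !scale0r !addr0 subr0 => gE kE.
by rewrite expr2 mulrA -kE (addrAC x (h *: v)) (addrAC x (s *: v)) -gE.
Qed.

(** The second difference is symmetric in [v] and [w], so the two mixed derivatives take a common
    value at points arbitrarily close to [x]; continuity carries the equality to [x]. *)
Lemma derive_comm f v w :
  (forall y, derivable f y v) -> (forall y, derivable f y w) ->
  (forall y, derivable ('D_v f) y w) -> (forall y, derivable ('D_w f) y v) ->
  continuous ('D_w ('D_v f)) -> continuous ('D_v ('D_w f)) ->
  'D_w ('D_v f) = 'D_v ('D_w f).
Proof.
move=> dv dw dvw dwv cvw cwv; apply/funext => x.
apply/eqP; rewrite -subr_eq0 -normr_le0; apply/ler_addgt0Pr => e e0; rewrite add0r.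
have e2 : 0 < e / 2 by rewrite divr_gt0.
have tri (a b c : R) : `|a - c| < e / 2 -> `|b - c| < e / 2 -> `|a - b| <= e.
  move=> ac bc; rewrite -(subrKA c) (le_trans (ler_normD _ _))//.
  by rewrite (splitr e) lerD ?ltW// distrC.
have /nbhs_ballP[r1 /= r10 H1] : \forall y \near x,
    `|'D_w ('D_v f) x - 'D_w ('D_v f) y| < e / 2.
  by move/cvgrPdist_lt : (cvw x) => /(_ _ e2).
have /nbhs_ballP[r2 /= r20 H2] : \forall y \near x,
    `|'D_v ('D_w f) x - 'D_v ('D_w f) y| < e / 2.
  by move/cvgrPdist_lt : (cwv x) => /(_ _ e2).
(* With [h = r / M], steps shorter than [h] along [v] and [w] move a point by less than [r]; the
   summand 1 keeps [M] positive when [v = w = 0]. *)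
pose M := `|v| + `|w| + 1.
have M0 : 0 < M by rewrite ltr_wpDl// addr_ge0.
pose r := Num.min r1 r2.
have r0 : 0 < r by rewrite lt_min r10.
pose h := r / M.
have h0 : 0 < h by rewrite divr_gt0.
have near_x a b s t : `|a| + `|b| + 1 = M -> 0 < s < h -> 0 < t < h ->
    ball x r (x + s *: a + t *: b).
  move=> ab /andP[s0 sh] /andP[t0 th].
  rewrite -ball_normE/= -addrA opprD addNKr normrN.
  rewrite (le_lt_trans (ler_normD _ _))// !normrZ !gtr0_norm//.
  have hM : h * M = r by rewrite /h divfK// gt_eqF.
  have sa : s * `|a| <= h * `|a| by rewrite ler_wpM2r// ltW.
  have tb : t * `|b| <= h * `|b| by rewrite ler_wpM2r// ltW.
  by rewrite -hM -ab !mulrDr; lra.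
have [s [t [sh th E1]]] := second_difference f v w x h h0 dv dvw.
have [s' [t' [sh' th' E2]]] := second_difference f w v x h h0 dw dwv.
have : 'D_w ('D_v f) (x + s *: v + t *: w) = 'D_v ('D_w f) (x + s' *: w + t' *: v).
  apply: (mulIf (x := h ^+ 2)); first by rewrite expf_neq0// gt_eqF.
  rewrite -E1 -E2 (addrAC x (h *: v)).
  by move: (f _) (f _) (f _) => a b c; ring.
have b1 : ball x r1 (x + s *: v + t *: w).
  by apply: (@le_ball _ _ _ r); [rewrite ge_min lexx|exact: near_x].
have b2 : ball x r2 (x + s' *: w + t' *: v).
  apply: (@le_ball _ _ _ r); first by rewrite ge_min lexx orbT.
  by apply: near_x => //; rewrite (addrC `|w|).
move: (H1 _ b1) (H2 _ b2) => {}b1 {}b2 E; rewrite -E in b2.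
exact: tri b1 b2.
Qed.
End MixedDerivatives.

(** * Elementary inequalities *)

(** The factor 2 is kept because the Young-type estimates that supply the two distances bound twice
    an absolute value. *)
Lemma dist_double_trans {R : realDomainType} {x y y' z a b : R} : y = y' ->
  2 * `|x - y| <= a -> 2 * `|z - y'| <= b -> 2 * `|x - z| <= a + b.
Proof.
move=> ->; rewrite (distrC z) => H1 H2; have := ler_normD (x - y') (y' - z).
by rewrite subrKA; lra.
Qed.

Lemma normr_young (R : realFieldType) (t a b : R) : 0 < t ->
  2 * `|a * b| <= t * a ^+ 2 + t^-1 * b ^+ 2.
Proof.
move=> t0; rewrite normrM -(real_normK (num_real a)) -(real_normK (num_real b)).
move: `|a| `|b| => {}a {}b; rewrite -subr_ge0.
have -> : t * a ^+ 2 + t^-1 * b ^+ 2 - 2 * (a * b) = t^-1 * (t * a - b) ^+ 2.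
  by field; rewrite gt_eqF.
by rewrite mulr_ge0 ?sqr_ge0// invr_ge0 ltW.
Qed.

(** * Square-integrable functions and integrated Young inequalities *)

Section L2.
Context {R : realType} {d : nat} {Omega : set 'rV[R]_d}.
Hypothesis mO : measurable Omega.
Local Notation point := 'rV[R]_d.
Local Notation mu := (lebesgue_rV R d).
Local Notation Iint f := (mu.-integrable Omega (EFin \o f)).
Implicit Types f g w : point -> R.

Lemma integrable_le {f} (g : point -> R) : measurable_fun Omega f -> Iint g ->
  (forall x, Omega x -> `|f x| <= g x) -> Iint f.
Proof.
move=> mf ig fg; apply: (le_integrable mO _ _ ig); first exact/measurable_EFinP.
by move=> x Ox /=; rewrite lee_fin (le_trans (fg x Ox))// ler_norm.
Qed.

Lemma integrable_add {f g} : Iint f -> Iint g -> Iint (fun x => f x + g x).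
Proof. by move=> fi gi; have := integrableD mO fi gi. Qed.

Lemma integrable_scale c {f} : Iint f -> Iint (fun x => c * f x).
Proof. by move=> fi; have := integrableZl mO c fi. Qed.

Lemma integrable_bigsum (I : finType) (F : I -> point -> R) :
  (forall i, Iint (F i)) -> Iint (fun x => \sum_i F i x).
Proof.
move=> Fi; have := integrable_sum mO (index_enum I) (P := xpredT) (fun i _ => Fi i).
by apply: eq_integrable => // x _; rewrite /= sumEFin.
Qed.

Lemma Rintegral_bigsum (I : finType) (F : I -> point -> R) :
  (forall i, Iint (F i)) ->
  \int[mu]_(x in Omega) (\sum_i F i x) = \sum_i \int[mu]_(x in Omega) F i x.
Proof.
move=> Fi.
suff H (s : seq I) : Iint (fun x => \sum_(i <- s) F i x) /\
    \int[mu]_(x in Omega) (\sum_(i <- s) F i x) =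
    \sum_(i <- s) \int[mu]_(x in Omega) F i x by have [] := H (index_enum I).
elim: s => [|i s [ihi ihs]].
  split.
    have -> : (fun x => \sum_(i <- [::]) F i x) = (fun=> 0).
      by apply/funext => x; rewrite big_nil.
    exact: integrable0.
  by under eq_Rintegral do rewrite big_nil; rewrite Rintegral_cst// mul0r big_nil.
have E : (fun x => \sum_(j <- i :: s) F j x) = (fun x => F i x + \sum_(j <- s) F j x).
  by apply/funext => x; rewrite big_cons.
by rewrite E big_cons; split; [exact: integrable_add|rewrite RintegralD// ihs].
Qed.

Lemma inL2_sqr {f} : inL2 Omega f -> Iint (fun x => f x ^+ 2).
Proof.
move=> [mf fi]; apply/integrableP; split.
  by apply/measurable_EFinP; exact: measurable_funX.
apply: le_lt_trans fi; apply: ge0_le_integral => //=.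
- apply/measurable_EFinP; apply: measurableT_comp => //.
  exact: measurable_funX.
- by apply/measurable_EFinP; exact: measurable_funX.
- by move=> x _; rewrite lee_fin ger0_norm ?sqr_ge0.
Qed.

Lemma inL2P {f} : measurable_fun Omega f -> Iint (fun x => f x ^+ 2) -> inL2 Omega f.
Proof.
move=> mf /integrableP[_ fi]; split => //; apply: le_lt_trans fi.
apply: ge0_le_integral => //=.
- by move=> x _; rewrite lee_fin sqr_ge0.
- by apply/measurable_EFinP; exact: measurable_funX.
- apply/measurable_EFinP; apply: measurableT_comp => //.
  exact: measurable_funX.
- by move=> x _; rewrite lee_fin ler_norm.
Qed.

Lemma inL2_mul {f g} : inL2 Omega f -> inL2 Omega g -> Iint (fun x => f x * g x).
Proof.
move=> f2 g2; have [mf _] := f2; have [mg _] := g2.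
apply: (integrable_le _ (measurable_funM mf mg)
  (integrable_add (inL2_sqr f2) (inL2_sqr g2))) => x _ /=.
have := (sqr_ge0 (f x + g x), sqr_ge0 (f x - g x), sqr_ge0 (f x), sqr_ge0 (g x)).
by move=> [[[H1 H2] H3] H4]; rewrite ler_norml; apply/andP; split; lra.
Qed.

Lemma inL2_bounded_mul w M f : measurable_fun Omega w ->
  (forall x, Omega x -> `|w x| <= M) -> inL2 Omega f ->
  inL2 Omega (fun x => w x * f x).
Proof.
move=> mw wM f2; have [mf _] := f2; apply: inL2P; first exact: measurable_funM.
apply: (integrable_le _ _ (integrable_scale (M ^+ 2) (inL2_sqr f2))).
  by apply: measurable_funX; exact: measurable_funM.
move=> x Ox; rewrite ger0_norm ?sqr_ge0// exprMn ler_wpM2r ?sqr_ge0//.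
have M0 : 0 <= M := le_trans (normr_ge0 _) (wM x Ox).
by rewrite -(real_normK (num_real (w x))) ler_pXn2r ?nnegrE ?wM.
Qed.

Lemma inL2_scale c {f} : inL2 Omega f -> inL2 Omega (fun x => c * f x).
Proof.
by apply: (@inL2_bounded_mul (cst c) `|c|) => //; exact: measurable_cst.
Qed.

Lemma inL2_add {f g} : inL2 Omega f -> inL2 Omega g -> inL2 Omega (fun x => f x + g x).
Proof.
move=> f2 g2; have [mf _] := f2; have [mg _] := g2.
apply: inL2P; first exact: measurable_funD.
apply: (integrable_le _ _ (integrable_scale 2
  (integrable_add (inL2_sqr f2) (inL2_sqr g2)))).
  by apply: measurable_funX; exact: measurable_funD.
move=> x _; rewrite ger0_norm ?sqr_ge0//.
by have := sqr_ge0 (f x - g x); lra.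
Qed.

Lemma inL2_sub {f g} : inL2 Omega f -> inL2 Omega g -> inL2 Omega (fun x => f x - g x).
Proof.
move=> f2 g2; have := inL2_add f2 (inL2_scale (-1) g2).
by under eq_fun do rewrite mulN1r.
Qed.

Lemma inL2_sum (I : finType) (F : I -> point -> R) :
  (forall i, inL2 Omega (F i)) -> inL2 Omega (fun x => \sum_i F i x).
Proof.
move=> FL; elim: (index_enum I) => [|i s ih].
  have -> : (fun x => \sum_(i <- [::]) F i x) = (fun=> 0).
    by apply/funext => x; rewrite big_nil.
  split; first exact: measurable_cst.
  by under eq_integral do rewrite expr0n; rewrite integral0 ltry.
have -> : (fun x => \sum_(j <- i :: s) F j x) = (fun x => F i x + \sum_(j <- s) F j x).
  by apply/funext => x; rewrite big_cons.
exact: inL2_add.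
Qed.

(** The pointwise bound also makes the measurable [phi] integrable. Every integrated Young
    inequality below rests on this one. *)
Lemma Rintegral_young (phi f g : point -> R) (t : R) :
  measurable_fun Omega phi -> Iint f -> Iint g ->
  (forall x, Omega x -> 2 * `|phi x| <= t * f x + t^-1 * g x) ->
  2 * `|\int[mu]_(x in Omega) phi x| <=
  t * (\int[mu]_(x in Omega) f x) + t^-1 * (\int[mu]_(x in Omega) g x).
Proof.
move=> mphi fi gi H.
have iS : Iint (fun x => t * f x + t^-1 * g x).
  by apply: integrable_add; exact: integrable_scale.
have iphi : Iint phi.
  apply: (integrable_le _ mphi iS) => x Ox.
  by rewrite (le_trans _ (H x Ox))// ler_peMl// ler1n.
rewrite -!RintegralZl// -RintegralD//; [|exact: integrable_scale..].
apply: (@le_trans _ _ (2 * \int[mu]_(x in Omega) `|phi x|)).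
  by rewrite ler_wpM2l// le_normr_Rintegral.
have inphi : Iint (fun x => `|phi x|) by have := integrable_abse iphi.
by rewrite -RintegralZl//; apply: le_Rintegral => //; exact: integrable_scale.
Qed.

(** Young's inequality with weight [t]: the squared distance is below [t ^+ 2], so its share
    [t^-1 * t ^+ 2] is again [t]. This turns L2 convergence into convergence of integrals of
    products. *)
Lemma Rintegral_mul_close F g h (t : R) : 0 < t ->
  inL2 Omega F -> inL2 Omega g -> inL2 Omega h ->
  (\int[mu]_(x in Omega) ((g x - h x) ^+ 2)%:E < (t ^+ 2)%:E)%E ->
  2 * `|\int[mu]_(x in Omega) (F x * g x) - \int[mu]_(x in Omega) (F x * h x)| <=
  t * (L2sq Omega F + 1).
Proof.
move=> t0 F2 g2 h2 small; have gh2 := inL2_sub g2 h2.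
rewrite -RintegralB//; [|exact: inL2_mul..].
apply: (@le_trans _ _ (t * L2sq Omega F + t^-1 * L2sq Omega (fun x => g x - h x))).
  apply: Rintegral_young => //; [|exact: inL2_sqr..|].
    by apply: measurable_funB; apply: measurable_funM; case: F2 g2 h2 => ? _ [? _] [].
  by move=> x _; rewrite -mulrBr; exact: normr_young.
rewrite mulrDr lerD2l mulr1 ler_pdivrMl// -expr2 ltW//.
rewrite -lte_fin; apply: le_lt_trans small.
by rewrite fineK// integrable_fin_num//; exact: inL2_sqr.
Qed.
End L2.

(** * Weak derivatives and the exchange of indices on H^1_0 *)

Section WeakDerivatives.
Context {R : realType} {d : nat} {Omega : set 'rV[R]_d}.
Hypothesis oO : open Omega.
Local Notation point := 'rV[R]_d.
Local Notation mu := (lebesgue_rV R d).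
Local Notation "'e_ i" := (delta_mx ord0 i : point) (at level 8, i at level 2).
Implicit Types (f g phi : point -> R) (i j : 'I_d).

Lemma measurable_open : measurable Omega.
Proof. exact: sub_sigma_algebra. Qed.
Let mO := measurable_open.

Lemma test_function_derive i phi : test_function Omega phi ->
  test_function Omega ('D_('e_ i) phi).
Proof.
move=> [sphi [K [cK KO phi0]]]; split.
  (* [foldr] applies the last index first, so differentiating ['D_('e_ i) phi] along [s] is
     differentiating [phi] along [rcons s i]. *)
  by move=> s; have := sphi (rcons s i); rewrite foldr_rcons.
exists K; split => // x nKx.
(* Outside [K], which is closed because compact, [phi] vanishes on a whole neighbourhood of [x]. *)
rewrite (near_eq_derive (g := cst 0)) ?derive_cst//.
have : nbhs x (~` K).
  apply: open_nbhs_nbhs; split => //; apply: closed_openC.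
  by apply: compact_closed cK; exact: norm_hausdorff.
by apply: filterS => y /phi0.
Qed.

Lemma test_function_derive_comm i j phi x : test_function Omega phi ->
  'D_('e_ j) ('D_('e_ i) phi) x = 'D_('e_ i) ('D_('e_ j) phi) x.
Proof.
move=> [sphi _]; have [_ d0] := sphi [::]; have [_ di] := sphi [:: i].
have [_ dj] := sphi [:: j]; have [cji _] := sphi [:: j; i].
have [cij _] := sphi [:: i; j].
have E := derive_comm phi _ _ (d0 i) (d0 j) (di j) (dj i) cji cij.
exact: (congr1 (@^~ x) E).
Qed.

Lemma wderivP i f : (exists g, is_weak_derivative Omega i f g) ->
  is_weak_derivative Omega i f (wderiv Omega i f).
Proof. exact: xgetPex. Qed.

(** Both sides are minus the integral of [f] against the same mixed second derivative of [phi],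
    whose first derivatives are themselves test functions. *)
Lemma wderiv_test_cross i j f phi : inH1 Omega f -> test_function Omega phi ->
  \int[mu]_(x in Omega) (wderiv Omega j f x * 'D_('e_ i) phi x) =
  \int[mu]_(x in Omega) (wderiv Omega i f x * 'D_('e_ j) phi x).
Proof.
move=> [_ H1] tphi.
have [_ _ Hi] := wderivP _ _ (H1 i).1; have [_ _ Hj] := wderivP _ _ (H1 j).1.
have Ei := Hi _ (test_function_derive j _ tphi).
have Ej := Hj _ (test_function_derive i _ tphi).
have E : \int[mu]_(x in Omega) (f x * 'D_('e_ j) ('D_('e_ i) phi) x) =
    \int[mu]_(x in Omega) (f x * 'D_('e_ i) ('D_('e_ j) phi) x).
  apply: eq_Rintegral => x _; by rewrite (test_function_derive_comm i j _ x tphi).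
exact: (oppr_inj (etrans (esym Ej) (etrans E Ei))).
Qed.

(** Meant for derivatives of approximating test functions: their square integrability is read off
    from the finite distance to [g]. *)
Lemma inL2_approx {g h} : inL2 Omega g -> continuous h ->
  (\int[mu]_(x in Omega) ((g x - h x) ^+ 2)%:E < +oo)%E -> inL2 Omega h.
Proof.
move=> g2 ch goo; have [mg _] := g2.
have mh : measurable_fun Omega h.
  by apply: measurable_funTS; exact: continuous_measurable_mxR.
have gh2 : inL2 Omega (fun x => g x - h x) by split => //; exact: measurable_funB.
have := inL2_sub mO g2 gh2.
by under eq_fun do rewrite subKr.
Qed.

(** [wderiv_test_cross] passes to the limit along test functions whose first derivatives approximate
    those of [g]. *)
Lemma wderiv_cross i j f g : inH1 Omega f -> inH10 Omega g ->
  \int[mu]_(x in Omega) (wderiv Omega j f x * wderiv Omega i g x) =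
  \int[mu]_(x in Omega) (wderiv Omega i f x * wderiv Omega j g x).
Proof.
move=> fH1 [gH1 [phi [tphi _ phig]]].
have fL k : inL2 Omega (wderiv Omega k f) by have [_ /(_ k)[]] := fH1.
have gL k : inL2 Omega (wderiv Omega k g) by have [_ /(_ k)[]] := gH1.
pose S k := L2sq Omega (wderiv Omega k f) + 1.
have S0 k : 0 < S k by rewrite ltr_wpDl// Rintegral_ge0// => x _; rewrite sqr_ge0.
have err k l n (t : R) : 0 < t ->
    (\int[mu]_(x in Omega) ((wderiv Omega k g x - 'D_('e_ k) (phi n) x) ^+ 2)%:E
      < (t ^+ 2)%:E)%E ->
    2 * `|\int[mu]_(x in Omega) (wderiv Omega l f x * wderiv Omega k g x) -
      \int[mu]_(x in Omega) (wderiv Omega l f x * 'D_('e_ k) (phi n) x)| <= t * S l.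
  move=> t0 small; apply: Rintegral_mul_close => //.
  apply: (inL2_approx (gL k)); last exact: lt_trans small (ltry _).
  exact: ((tphi n).1 [:: k]).1.
have close (t : R) : 0 < t ->
  2 * `|\int[mu]_(x in Omega) (wderiv Omega j f x * wderiv Omega i g x) -
        \int[mu]_(x in Omega) (wderiv Omega i f x * wderiv Omega j g x)| <=
  t * (S j + S i).
  move=> t0; have t20 : (0 < (t ^+ 2)%:E)%E by rewrite lte_fin exprn_gt0.
  have near_small k : \forall n \near \oo,
     (\int[mu]_(x in Omega) ((wderiv Omega k g x - 'D_('e_ k) (phi n) x) ^+ 2)%:E
      < (t ^+ 2)%:E)%E.
    have t2N : nbhs 0%E [set y : \bar R | (y < (t ^+ 2)%:E)%E].
      by apply: open_nbhs_nbhs; split => //; exact: open_ereal_lt_ereal.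
    exact: (phig k _ t2N).
  (* One index [n] has to be good for both derivatives of [g]. *)
  have [n [ni nj]] := filter_ex (filterI (near_small i) (near_small j)).
  have E := wderiv_test_cross i j _ _ fH1 (tphi n).
  rewrite mulrDr; exact: (dist_double_trans E (err _ j _ _ t0 ni) (err _ i _ _ t0 nj)).
apply: subr0_eq; apply/eqP; rewrite -normr_le0.
apply/ler_addgt0Pr => e e0; rewrite add0r.
have SS : 0 < S j + S i by rewrite addr_gt0.
have := close (e / (S j + S i)) (divr_gt0 e0 SS).
by rewrite divfK ?gt_eqF//; apply: le_trans; rewrite ler_peMl// ler1n.
Qed.
End WeakDerivatives.

(** * Frobenius products and L2 products of matrix fields *)

Section Frobenius.
Context {R : realType} {m n : nat}.
Implicit Types A B C : 'M[R]_(m, n).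

Lemma frobC A B : frob A B = frob B A.
Proof. by apply: eq_bigr => i _; apply: eq_bigr => j _; rewrite mulrC. Qed.

Lemma frob_ge0 A : 0 <= frob A A.
Proof. by apply: sumr_ge0 => i _; apply: sumr_ge0 => j _; rewrite -expr2 sqr_ge0. Qed.

Lemma frobBl A B C : frob (A - B) C = frob A C - frob B C.
Proof.
rewrite /frob -sumrB; apply: eq_bigr => i _; rewrite -sumrB; apply: eq_bigr => j _.
by rewrite !mxE mulrBl.
Qed.

Lemma frob_young (t : R) A B : 0 < t ->
  2 * `|frob A B| <= t * frob A A + t^-1 * frob B B.
Proof.
move=> t0; rewrite /frob !mulr_sumr -big_split/= -ler_pdivlMl//.
apply: (le_trans (ler_norm_sum _ _ _)); rewrite mulr_sumr; apply: ler_sum => i _.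
rewrite !mulr_sumr -big_split/= mulr_sumr.
apply: (le_trans (ler_norm_sum _ _ _)); apply: ler_sum => j _.
by rewrite ler_pdivlMl// -!expr2; exact: normr_young.
Qed.
End Frobenius.

Section L2matrix.
Context {R : realType} {d : nat} {Omega : set 'rV[R]_d}.
Hypothesis mO : measurable Omega.
Local Notation point := 'rV[R]_d.
Local Notation mu := (lebesgue_rV R d).
Local Notation Iint f := (mu.-integrable Omega (EFin \o f)).

(** Vector fields are one-row matrices, so this single notion serves displacements and velocities as
    well as their gradients. *)
Definition inL2mx {m n} (A : point -> 'M[R]_(m, n)) : Prop :=
  forall i j, inL2 Omega (fun x => A x i j).

Section dims.
Context {m n : nat}.
Implicit Types A B C : point -> 'M[R]_(m, n).

Lemma inL2mx_sub {A B} : inL2mx A -> inL2mx B -> inL2mx (fun x => A x - B x).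
Proof.
move=> A2 B2 i j.
rewrite (_ : (fun x => _) = (fun x => A x i j - B x i j)); first exact: inL2_sub.
by apply/funext => x; rewrite !mxE.
Qed.

Lemma frob_integrable {A B} : inL2mx A -> inL2mx B -> Iint (fun x => frob (A x) (B x)).
Proof.
move=> A2 B2; apply: integrable_bigsum => // i; apply: integrable_bigsum => // j.
exact: inL2_mul.
Qed.

Lemma L2dot_ge0 A : 0 <= L2dot Omega A A.
Proof. by apply: Rintegral_ge0 => x _; exact: frob_ge0. Qed.

Lemma L2norm_sqr A : L2norm Omega A ^+ 2 = L2dot Omega A A.
Proof. by rewrite sqr_sqrtr// L2dot_ge0. Qed.

Lemma L2dotC A B : L2dot Omega A B = L2dot Omega B A.
Proof. by apply: eq_Rintegral => x _; rewrite frobC. Qed.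

Lemma L2dotBl A B C : inL2mx A -> inL2mx B -> inL2mx C ->
  L2dot Omega (fun x => A x - B x) C = L2dot Omega A C - L2dot Omega B C.
Proof.
move=> A2 B2 C2; rewrite /L2dot -RintegralB//; [|exact: frob_integrable..].
by apply: eq_Rintegral => x _; rewrite frobBl.
Qed.

(** The polarization behind implicit Euler: the discrete time derivative tested with the new value
    gives a difference of squares, which telescopes, plus the square of the increment. *)
Lemma L2dot_subl2 A B : inL2mx A -> inL2mx B ->
  2 * L2dot Omega (fun x => A x - B x) A =
  L2dot Omega A A - L2dot Omega B B +
  L2dot Omega (fun x => A x - B x) (fun x => A x - B x).
Proof.
move=> A2 B2; have AB2 := inL2mx_sub A2 B2.
rewrite (L2dotBl _ _ (fun x => A x - B x))// !(L2dotC _ (fun x => A x - B x)).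
by rewrite !L2dotBl// (L2dotC B A); ring.
Qed.

Lemma weighted_frob_integrable (w : point -> R) M A B : measurable_fun Omega w ->
  (forall x, Omega x -> `|w x| <= M) -> inL2mx A -> inL2mx B ->
  Iint (fun x => w x * frob (A x) (B x)).
Proof.
move=> mw wM A2 B2.
have wA2 : inL2mx (fun x => w x *: A x).
  move=> i j; rewrite (_ : (fun x => _) = (fun x => w x * A x i j)).
    exact: (inL2_bounded_mul mO w M).
  by apply/funext => x; rewrite !mxE.
apply: eq_integrable (frob_integrable wA2 B2) => // x _ /=; congr EFin.
rewrite mulr_sumr; apply: eq_bigr => i _; rewrite mulr_sumr.
by apply: eq_bigr => j _; rewrite mxE mulrA.
Qed.

Lemma weighted_young (w : point -> R) M t A B : 0 < t ->
  measurable_fun Omega w -> (forall x, Omega x -> `|w x| <= M) ->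
  inL2mx A -> inL2mx B ->
  2 * `|\int[mu]_(x in Omega) (w x * frob (A x) (B x))| <=
  M * (t * L2dot Omega A A + t^-1 * L2dot Omega B B).
Proof.
move=> t0 mw wM A2 B2.
have E (X : point -> 'M[R]_(m, n)) : inL2mx X ->
    M * L2dot Omega X X = \int[mu]_(x in Omega) (M * frob (X x) (X x)).
  by move=> X2; rewrite RintegralZl//; exact: frob_integrable.
rewrite mulrDr !(mulrCA M) !E//.
apply: Rintegral_young => //; [|exact/integrable_scale/frob_integrable..|].
  apply: measurable_funM => //.
  by have /integrableP[/measurable_EFinP] := frob_integrable A2 B2.
move=> x Ox; rewrite normrM mulrCA !(mulrCA _ M) -mulrDr.
by rewrite ler_pM ?wM ?mulr_ge0// frob_young.
Qed.

Lemma L2dot_young {t A B} : 0 < t -> inL2mx A -> inL2mx B ->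
  2 * `|L2dot Omega A B| <= t * L2dot Omega A A + t^-1 * L2dot Omega B B.
Proof.
move=> t0 A2 B2.
have /= := @weighted_young (cst 1) 1 t A B t0 (@measurable_cst _ _ _ _ _ _) _ A2 B2.
rewrite mul1r; under eq_Rintegral do rewrite mul1r.
by apply => x _; rewrite normr1.
Qed.

Lemma L2dot_sub_le A B : inL2mx A -> inL2mx B ->
  L2dot Omega (fun x => A x - B x) (fun x => A x - B x) <=
  2 * (L2dot Omega A A + L2dot Omega B B).
Proof.
move=> A2 B2; have AB2 := inL2mx_sub A2 B2.
rewrite L2dotBl// !(L2dotC _ (fun x => A x - B x)) !L2dotBl// (L2dotC B A).
have := L2dot_young ltr01 A2 B2; rewrite invr1 !mul1r.
move: (L2dot _ _ _) (L2dot _ _ _) (L2dot _ _ _) => a b c.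
by have := ler_norm (- c); rewrite normrN; lra.
Qed.
End dims.

Lemma weighted_young_scalar (w f g : point -> R) M t : 0 < t ->
  measurable_fun Omega w -> (forall x, Omega x -> `|w x| <= M) ->
  inL2 Omega f -> inL2 Omega g ->
  2 * `|\int[mu]_(x in Omega) (w x * (f x * g x))| <=
  M * (t * L2sq Omega f + t^-1 * L2sq Omega g).
Proof.
move=> t0 mw wM f2 g2.
have E h : inL2 Omega h -> M * L2sq Omega h = \int[mu]_(x in Omega) (M * h x ^+ 2).
  by move=> h2; rewrite RintegralZl//; exact: inL2_sqr.
rewrite mulrDr !(mulrCA M) !E//.
apply: Rintegral_young => //; [|exact/integrable_scale/inL2_sqr..|].
  by do 2 apply: measurable_funM => //; [exact: f2.1|exact: g2.1].
move=> x Ox; rewrite normrM mulrCA !(mulrCA _ M) -mulrDr.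
by rewrite ler_pM ?wM ?mulr_ge0// normr_young.
Qed.
End L2matrix.

(** * Gradient, symmetric gradient and divergence *)

Section Gradients.
Context {R : realType} {d : nat} {Omega : set 'rV[R]_d}.
Hypothesis oO : open Omega.
Let mO := measurable_open oO.
Local Notation point := 'rV[R]_d.
Local Notation mu := (lebesgue_rV R d).
Implicit Types z : point -> 'rV[R]_d.

Lemma inH10v_inL2mx {z} : inH10v Omega z -> inL2mx (Omega := Omega) z.
Proof. by move=> Hz i j; rewrite ord1; have [[]] := Hz j. Qed.

Lemma inH10v_wderiv {z} i j : inH10v Omega z ->
  inL2 Omega (wderiv Omega j (component z i)).
Proof. by move=> Hz; have [[_ /(_ j)[]]] := Hz i. Qed.

Lemma inL2mx_grad {z} : inH10v Omega z -> inL2mx (Omega := Omega) (grad Omega z).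
Proof.
move=> Hz i j; have := inH10v_wderiv i j Hz.
rewrite (_ : (fun x => _) = wderiv Omega j (component z i))//.
by apply/funext => x; rewrite mxE.
Qed.

Lemma inL2mx_symgrad {z} : inH10v Omega z ->
  inL2mx (Omega := Omega) (symgrad Omega z).
Proof.
move=> Hz i j; rewrite (_ : (fun x => _) = (fun x => 2^-1 *
    (wderiv Omega j (component z i) x + wderiv Omega i (component z j) x))).
  by apply: inL2_scale => //; apply: inL2_add => //; exact: inH10v_wderiv.
by apply/funext => x; rewrite !mxE.
Qed.

Lemma divE z x : div Omega z x = \sum_i wderiv Omega i (component z i) x.
Proof. by apply: eq_bigr => i _; rewrite mxE. Qed.

Lemma inL2_div {z} : inH10v Omega z -> inL2 Omega (div Omega z).
Proof.
move=> Hz; rewrite (_ : div Omega z = (fun x => \sum_i wderiv Omega i (component z i) x)).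
  by apply: inL2_sum => // i; exact: inH10v_wderiv.
by apply/funext => x; rewrite divE.
Qed.

(** Averaging the entries [(i, j)] and [(j, i)] lets [G] be compared termwise with its symmetric
    part and with the trace of its square, each time by [0 <= (a - b) ^+ 2]. *)
Lemma frob_symmetrize (G : 'M[R]_d) :
  frob G G = \sum_i \sum_j 2^-1 * (G i j ^+ 2 + G j i ^+ 2).
Proof.
transitivity (2^-1 * (frob G G + \sum_i \sum_j G j i ^+ 2)).
  by rewrite exchange_big/= -/(frob G G); field.
rewrite /frob -big_split/= mulr_sumr; apply: eq_bigr => i _.
by rewrite -big_split/= mulr_sumr.
Qed.

Lemma frob_symgrad_le z x :
  frob (symgrad Omega z x) (symgrad Omega z x) <= frob (grad Omega z x) (grad Omega z x).
Proof.
rewrite [leRHS]frob_symmetrize; apply: ler_sum => i _; apply: ler_sum => j _; rewrite !mxE.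
move: (wderiv _ _ _ _) (wderiv _ _ _ _) => a b.
by have := sqr_ge0 (a - b); lra.
Qed.

Lemma L2dot_symgrad_le z : inH10v Omega z ->
  L2dot Omega (symgrad Omega z) (symgrad Omega z) <=
  L2dot Omega (grad Omega z) (grad Omega z).
Proof.
move=> Hz; apply: le_Rintegral => //.
- by apply: frob_integrable => //; exact: inL2mx_symgrad.
- by apply: frob_integrable => //; exact: inL2mx_grad.
- by move=> x _; exact: frob_symgrad_le.
Qed.

(* On [H^1_0] the integral of [d_i z_i * d_j z_j] is that of [d_j z_i * d_i z_j],
   so that [(div z)^2] has the same integral as [tr ((grad z)^2)]; without the
   boundary condition the constant would be [d]. *)
Lemma L2sq_div_le z : inH10v Omega z ->
  L2sq Omega (div Omega z) <= L2dot Omega (grad Omega z) (grad Omega z).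
Proof.
move=> Hz; pose G i j := wderiv Omega j (component z i).
have GL i j : inL2 Omega (G i j) by exact: inH10v_wderiv.
have GG i j k l : mu.-integrable Omega (EFin \o (fun x => G i j x * G k l x)).
  by apply: inL2_mul.
have -> : L2sq Omega (div Omega z) =
    \sum_i \sum_j \int[mu]_(x in Omega) (G i i x * G j j x).
  rewrite -[RHS](eq_bigr _ (fun i _ => Rintegral_bigsum mO _ _ (fun j => GG i i j j))).
  rewrite -Rintegral_bigsum//; last by move=> i; apply: integrable_bigsum.
  apply: eq_Rintegral => x _; rewrite divE expr2 mulr_suml.
  by apply: eq_bigr => i _; rewrite mulr_sumr.
have -> : \sum_i \sum_j \int[mu]_(x in Omega) (G i i x * G j j x) =
    \sum_i \sum_j \int[mu]_(x in Omega) (G i j x * G j i x).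
  apply: eq_bigr => i _; apply: eq_bigr => j _.
  exact: (wderiv_cross oO j i _ _ (Hz i).1 (Hz j)).
rewrite -[leLHS](eq_bigr _ (fun i _ => Rintegral_bigsum mO _ _ (fun j => GG i j j i))).
rewrite -Rintegral_bigsum//; last by move=> i; apply: integrable_bigsum.
apply: le_Rintegral => //.
- by apply: integrable_bigsum => // i; apply: integrable_bigsum.
- by apply: frob_integrable => //; exact: inL2mx_grad.
move=> x _.
rewrite frob_symmetrize; apply: ler_sum => i _; apply: ler_sum => j _.
rewrite !mxE -!/(G _ _); move: (G i j x) (G j i x) => a b.
by have := sqr_ge0 (a - b); lra.
Qed.
End Gradients.

(** * Bounds and continuity of the truncated coefficients *)

Section Coefficients.
Context {R : realType} (d : nat) (m : material R) (l1 l2 delta : R).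
Hypotheses (delta0 : 0 <= delta) (E2_lt0 : E2 m < 0).
Hypotheses (small1 : 0 < 1 - `|l1| * delta)
  (small2 : 0 < gamma3 d m - `|gamma4 d m l1 l2| * delta)
  (small3 : 0 < 1 - `|l2| * delta).
Local Notation g1 := (gamma1 l1 delta).
Local Notation g2 := (gamma2 l1 delta).
Local Notation g5 := (gamma5 d m l1 l2 delta).
Local Notation g6 := (gamma6 d m l1 l2 delta).
Local Notation g7 := (gamma7 l2 delta).
Local Notation g8 := (gamma8 l2 delta).

(** The truncation is written as a lattice expression because continuity is then immediate. *)
Lemma truncationE : truncation delta = cst (- delta) \max (id \min cst delta).
Proof.
apply/funext => f; rewrite /truncation /Order.max_fun /Order.min_fun /=.
have [fd|df] := lerP `|f| delta.
  move: fd; rewrite ler_norml => /andP[df fd].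
  by rewrite (min_idPl fd) (max_idPr df).
have [f0|f0] := ltrP f 0.
  rewrite ltr0_norm// in df.
  have -> : Num.min f delta = f by apply/min_idPl/ltW/(lt_le_trans f0).
  have -> : Num.max (- delta) f = - delta by apply/max_idPl; rewrite lerNr ltW.
  by rewrite ltr0_sg// mulrN1.
rewrite ger0_norm// in df.
have -> : Num.min f delta = delta by apply/min_idPr/ltW.
have -> : Num.max (- delta) delta = delta by apply/max_idPr; rewrite ge0_cp.
by rewrite gtr0_sg ?mulr1// (le_lt_trans delta0).
Qed.

Lemma truncation_bound f : `|truncation delta f| <= delta.
Proof.
rewrite /truncation; case: ifP => // _; rewrite normrM ger0_norm//.
by rewrite normr_sg ler_piMr// lern1; case: (f != 0).
Qed.

Lemma continuous_truncation : continuous (truncation delta).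
Proof.
rewrite truncationE => x; apply: continuous_max; first exact: cvg_cst.
by apply: continuous_min; [exact: cvg_id|exact: cvg_cst].
Qed.

Lemma affine_bounds (a b t : R) : `|t| <= delta ->
  a - `|b| * delta <= a + b * t <= a + `|b| * delta.
Proof.
by move=> td; rewrite !lerD2l -ler_norml normrM ler_wpM2l.
Qed.

Lemma invf_bounds (a b x : R) : 0 < a -> a <= x <= b -> b^-1 <= x^-1 <= a^-1.
Proof.
move=> a0 /andP[ax xb]; have x0 := lt_le_trans a0 ax.
by rewrite !lef_pV2 ?posrE ?ax ?xb//; exact: lt_le_trans xb.
Qed.

(** Together with [pressure_coef], the nonlinear weight of the scheme as a function of the old
    divergence; being continuous in one real variable, it stays measurable after composition. *)
Definition shear_coef (f : R) : R := (1 + l1 * truncation delta f)^-1.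

Definition pressure_coef (f : R) : R :=
  (1 + l2 * truncation delta f) * shear_coef f / Flin d m l1 l2 (truncation delta f).

Lemma FlinE (f : R) : Flin d m l1 l2 f = gamma3 d m + gamma4 d m l1 l2 * f.
Proof. by rewrite /Flin /gamma3 /gamma4 (ltr0_norm E2_lt0); ring. Qed.

Lemma shear_coef_bounds f : g1 <= shear_coef f <= g2.
Proof. by apply: invf_bounds small1 _; exact/affine_bounds/truncation_bound. Qed.

Lemma FlinV_bounds f : g5 <= (Flin d m l1 l2 (truncation delta f))^-1 <= g6.
Proof.
rewrite FlinE; apply: invf_bounds small2 _.
exact/affine_bounds/truncation_bound.
Qed.

Lemma gamma1_gt0 : 0 < g1.
Proof. by rewrite invr_gt0 ltr_pwDl// mulr_ge0. Qed.

Lemma gamma2_gt0 : 0 < g2. Proof. by rewrite invr_gt0. Qed.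

Lemma gamma5_gt0 : 0 < g5.
Proof.
rewrite invr_gt0 (lt_le_trans small2)// lerD2l.
by rewrite (@le_trans _ _ 0)// ?oppr_le0 mulr_ge0.
Qed.

Lemma gamma6_gt0 : 0 < g6. Proof. by rewrite invr_gt0. Qed.

Lemma gamma7_gt0 : 0 < g7. Proof. by []. Qed.

Lemma gamma8_gt0 : 0 < g8.
Proof. by rewrite ltr_pwDl// mulr_ge0. Qed.

Lemma pressure_coef_bounds f : g7 * g1 * g5 <= pressure_coef f <= g8 * g2 * g6.
Proof.
have /andP[s1 s2] := shear_coef_bounds f.
have /andP[F1 F2] := FlinV_bounds f.
have /andP[n1 n2] := affine_bounds 1 l2 _ (truncation_bound f).
have p1 := ltW gamma1_gt0; have p5 := ltW gamma5_gt0; have p7 := ltW gamma7_gt0.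
have q1 := le_trans p1 s1; have q5 := le_trans p5 F1; have q7 := le_trans p7 n1.
by apply/andP; split; rewrite !ler_pM// mulr_ge0.
Qed.

Lemma continuous_affine_truncation (a b : R) :
  continuous (fun f => a + b * truncation delta f).
Proof.
move=> x; apply: cvgD; first exact: cvg_cst.
by apply: cvgMr; exact: continuous_truncation.
Qed.

Lemma continuous_shear_coef : continuous shear_coef.
Proof.
move=> x; apply: (cvgV _ (continuous_affine_truncation 1 l1 x)).
have /andP[+ _] := affine_bounds 1 l1 _ (truncation_bound x).
by move=> /(lt_le_trans small1)/lt0r_neq0.
Qed.

Lemma continuous_pressure_coef : continuous pressure_coef.
Proof.
rewrite (_ : pressure_coef = (fun f => (1 + l2 * truncation delta f) * shear_coef f *
    (gamma3 d m + gamma4 d m l1 l2 * truncation delta f)^-1)); last first.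
  by apply/funext => f; rewrite /pressure_coef FlinE.
move=> x; apply: cvgM.
  by apply: cvgM; [exact: continuous_affine_truncation|exact: continuous_shear_coef].
apply: (cvgV _ (continuous_affine_truncation _ _ x)).
have /andP[+ _] :=
  affine_bounds (gamma3 d m) (gamma4 d m l1 l2) _ (truncation_bound x).
by move=> /(lt_le_trans small2)/lt0r_neq0.
Qed.
End Coefficients.

(** * Real inequalities behind the energy estimate *)

(** The weight [t = 2 * p / (a * c)] is the one that puts exactly [p] in front of [x]. *)
Lemma young_absorb (R : realFieldType) (s a c p x y : R) :
  0 < a -> 0 < c -> 0 < p ->
  (forall t, 0 < t -> 2 * `|s| <= c * (t * x + t^-1 * y)) ->
  a * `|s| <= p * x + (a * c) ^+ 2 / (4 * p) * y.
Proof.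
move=> a0 c0 p0 H; have := H (2 * p / (a * c)).
rewrite !(divr_gt0, mulr_gt0)// => /(_ isT) {}H.
have -> : p * x + (a * c) ^+ 2 / (4 * p) * y =
    a / 2 * (c * (2 * p / (a * c) * x + (2 * p / (a * c))^-1 * y)).
  by field; rewrite !gt_eqF.
have -> : a * `|s| = a / 2 * (2 * `|s|) by field.
by rewrite ler_wpM2l// divr_ge0// ltW.
Qed.

(** [I1] and [I2] stand for the shear and pressure integrals of the elastic form at [u] and [z], [e]
    and [X] for the squared strains of [u] and [z], [f] and [Y] for their squared divergences, [Z]
    for the squared gradient of [z]. *)
Lemma young_absorb_pair (R : realFieldType)
    (k E b g2 g5 g6 g7 g8 D1 D2 I1 I2 e f X Y Z : R) :
  0 < k -> 0 < E -> 0 < b -> 0 < g2 -> 0 < g5 -> 0 < g6 -> 0 < g7 -> 0 < g8 ->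
  D1 = (g6 * g8) ^+ 2 / (g5 * g7) * b -> D2 = 1 + D1 / 2 ->
  (forall t, 0 < t -> 2 * `|I1| <= g2 * (t * e + t^-1 * X)) ->
  (forall t, 0 < t -> 2 * `|I2| <= g8 * g2 * g6 * (t * f + t^-1 * Y)) ->
  X <= Z -> Y <= Z ->
  - (E^-1 * I1 + b / E * I2) <=
  k / 2 * (g2 / E) ^+ 2 * D2 * (e + 2 * b * (g5 * g7) * f) + (2 * k)^-1 * Z.
Proof.
move=> k0 E0 b0 g20 g50 g60 g70 g80 ED1 ED2 H1 H2 XZ YZ.
have D10 : 0 < D1 by rewrite ED1 mulr_gt0// divr_gt0 ?exprn_gt0 ?mulr_gt0.
have D20 : 0 < D2 by rewrite ED2 ltr_pwDl// divr_ge0// ltW.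
(* The coefficient prescribed for [e]; that of [f] is [p] times the weight of the divergence in the
   elastic energy. *)
set p := k / 2 * (g2 / E) ^+ 2 * D2.
have p0 : 0 < p by rewrite /p !mulr_gt0 ?exprn_gt0 ?divr_gt0 ?invr_gt0.
have q0 : 0 < p * (2 * b * (g5 * g7)) by apply: mulr_gt0 => //; rewrite !mulr_gt0.
have {}H1 := fun E0' => young_absorb _ _ E^-1 g2 p _ _ E0' g20 p0 H1.
have {}H2 := fun bE c0 => young_absorb _ _ (b / E) (g8 * g2 * g6) _ _ _ bE c0 q0 H2.
have {H1 XZ} H1 : - (E^-1 * I1) <= p * e + (2 * k * D2)^-1 * Z.
  apply: (@le_trans _ _ (E^-1 * `|I1|)).
    by rewrite -mulrN ler_wpM2l ?invr_ge0 ?(ltW E0)// -normrN ler_norm.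
  rewrite (le_trans (H1 _)) ?invr_gt0// lerD2l.
  have -> : (E^-1 * g2) ^+ 2 / (4 * p) = (2 * k * D2)^-1.
    by rewrite /p; field; rewrite !gt_eqF.
  by rewrite ler_wpM2l// invr_ge0 !mulr_ge0// ltW.
have {H2 YZ} H2 : - (b / E * I2) <= p * (2 * b * (g5 * g7)) * f +
    (2 * k * D2)^-1 * (D1 / 2) * Z.
  apply: (@le_trans _ _ (b / E * `|I2|)).
    by rewrite -mulrN ler_wpM2l ?divr_ge0 ?(ltW E0) ?(ltW b0)// -normrN ler_norm.
  rewrite (le_trans (H2 _ _)) ?divr_gt0 ?mulr_gt0// lerD2l.
  have -> : (b / E * (g8 * g2 * g6)) ^+ 2 / (4 * (p * (2 * b * (g5 * g7)))) =
      (2 * k * D2)^-1 * (D1 / 2).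
    by rewrite /p ED1; field; rewrite !gt_eqF.
  by rewrite ler_wpM2l// mulr_ge0 ?invr_ge0 ?divr_ge0 ?mulr_ge0// ltW.
(* The two remainders add up: [1 + D1 / 2 = D2] cancels the factor [D2^-1]. *)
have <- : (2 * k * D2)^-1 * Z + (2 * k * D2)^-1 * (D1 / 2) * Z = (2 * k)^-1 * Z.
  have -> : D1 / 2 = D2 - 1 by rewrite ED2 addrAC subrr add0r.
  by field; rewrite !gt_eqF.
by rewrite opprD mulrDr mulrA addrACA lerD.
Qed.

(** In the application [A], [A0], [W] are the squares of the new velocity, the old velocity and
    their difference; [B], [B0], [Wu] the same for the displacement; [G] is the squared velocity
    gradient, [S] the elastic energy, [I] the elastic form at the interpolant, [q] the product of
    the latter with the new velocity, and [s1 + s2] the coupling term. The last inequality, times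
    [k * D3 / al], swallows the terms in [Wu] and [S]. *)
Lemma energy_step {R : realFieldType}
    {al nu rho E g1 g2 D2 dt h P K k A A0 W G B B0 Wu S q s1 s2 I D3 D4 : R} :
  0 < al -> 0 < nu -> 0 < rho -> 0 < E -> 0 < g1 -> 0 < D2 -> 0 < dt -> 0 < k ->
  0 <= Wu -> 0 <= S ->
  al / dt * s1 <= k / 2 * (al * h / dt) ^+ 2 * Wu + nu / 6 * G ->
  al * q <= k / 2 * (al * P) ^+ 2 * A + nu / 6 * G ->
  - I <= k / 2 * (g2 / E) ^+ 2 * D2 * S + nu / 6 * G ->
  rho / (2 * dt) * (A - A0 + W) + nu * G + al * A = al / dt * (s1 + s2) ->
  al / dt * s2 + I = al * q ->
  al / (2 * dt) * (B - B0 + Wu) + g1 / (2 * E) * S <=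
    (al * P * K) ^+ 2 * E / (2 * g1) * A ->
  D3 = (al * h) ^+ 2 / dt + al / E * (g2 ^+ 2 / g1) * D2 ->
  D4 = (al * P) ^+ 2 * (1 + E * K ^+ 2 / (al * g1) * D3) ->
  A - A0 + k / rho * D3 * (B - B0) +
    (W + nu / rho * (dt * G) + 2 * al / rho * (dt * A)) <= k / rho * D4 * dt * A.
Proof.
move=> al0 nu0 rho0 E0 g10 D20 dt0 k0 Wu0 S0 H1 H2 H3 Hv Hel Hu ED3 ED4.
have {H1 H2 H3 Hel} Hv' : rho / (2 * dt) * (A - A0 + W) + nu / 2 * G + al * A <=
    k / 2 * (al * h / dt) ^+ 2 * Wu + k / 2 * (al * P) ^+ 2 * A +
    k / 2 * (g2 / E) ^+ 2 * D2 * S.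
  by rewrite mulrDr in Hv; lra.
have a10 : 0 <= (al * h) ^+ 2 / dt by rewrite divr_ge0 ?sqr_ge0// ltW.
have a20 : 0 <= al / E * (g2 ^+ 2 / g1) * D2.
  apply: mulr_ge0; last exact: ltW.
  by apply: mulr_ge0; rewrite divr_ge0 ?sqr_ge0// ltW.
have D30 : 0 <= D3 by rewrite ED3 addr_ge0.
(* The first summand of [D3] is exactly what the increment [Wu] needs. *)
have D3Wu : k / 2 * (al * h / dt) ^+ 2 * Wu <= k * D3 / (2 * dt) * Wu.
  rewrite ler_wpM2r//.
  have -> : k / 2 * (al * h / dt) ^+ 2 = k * ((al * h) ^+ 2 / dt) / (2 * dt).
    by field; rewrite gt_eqF.
  rewrite ler_wpM2r ?invr_ge0 ?mulr_ge0 ?(ltW dt0)// ler_wpM2l ?(ltW k0)//.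
  by rewrite ED3 lerDl.
(* The second summand of [D3] is matched to the elastic energy in the same way. *)
have D3S : k / 2 * (g2 / E) ^+ 2 * D2 * S <= k * D3 / al * (g1 / (2 * E)) * S.
  rewrite ler_wpM2r//.
  have -> : k / 2 * (g2 / E) ^+ 2 * D2 =
      k * (al / E * (g2 ^+ 2 / g1) * D2) / al * (g1 / (2 * E)).
    by field; rewrite !gt_eqF.
  rewrite ler_wpM2r ?divr_ge0 ?mulr_ge0 ?(ltW g10) ?(ltW E0)//.
  rewrite ler_wpM2r ?invr_ge0 ?(ltW al0)// ler_wpM2l ?(ltW k0)//.
  by rewrite ED3 lerDr.
have kD : 0 <= k * D3 / al by rewrite !mulr_ge0 ?invr_ge0// ltW.
have {Hu} Hu' := ler_wpM2l kD Hu.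
have Eu : k * D3 / al * (al / (2 * dt) * (B - B0 + Wu) + g1 / (2 * E) * S) =
    k * D3 / (2 * dt) * (B - B0) + k * D3 / (2 * dt) * Wu +
    k * D3 / al * (g1 / (2 * E)) * S.
  by field; rewrite !gt_eqF.
(* The summand 1 in [D4] pays for the term [k / 2 * (al * P) ^+ 2 * A]. *)
have Ek : k * D3 / al * ((al * P * K) ^+ 2 * E / (2 * g1) * A) =
    k / 2 * D4 * A - k / 2 * (al * P) ^+ 2 * A.
  by rewrite ED4; field; rewrite !gt_eqF.
rewrite Eu Ek in Hu'.
have {Hv' Hu' D3Wu D3S} main : rho / (2 * dt) * (A - A0 + W) + nu / 2 * G + al * A +
    k * D3 / (2 * dt) * (B - B0) <= k / 2 * D4 * A by lra.
(* Scaling by [2 * dt / rho] gives [A - A0] the coefficient 1. *)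
have c0 : 0 <= 2 * dt / rho by rewrite divr_ge0 ?mulr_ge0// ltW.
have := ler_wpM2l c0 main.
have -> : 2 * dt / rho * (k / 2 * D4 * A) = k / rho * D4 * dt * A.
  by field; rewrite gt_eqF.
apply: le_trans; rewrite le_eqVlt; apply/orP; left; apply/eqP.
by field; rewrite !gt_eqF.
Qed.

(** Poincaré and Korn bound [B] by [P ^+ 2 * K ^+ 2 * e], so half of the strain part [e] absorbs the
    Young remainder. The divergence part [f] is kept whole, hence the factor 2 in front of [b]. *)
Lemma elastic_energy_balance {R : realFieldType}
    {al dt E g b e f A B B0 Wu G Q s q I P K : R} :
  0 < dt -> 0 < E -> 0 < g -> 0 < P -> 0 < K ->
  al / dt * s + I = al * q -> g / E * (e + b * f) <= I ->
  2 * s = B - B0 + Wu -> B <= P ^+ 2 * G -> G <= K ^+ 2 * e ->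
  al * q <= Q * A + g / (2 * E) * (P ^+ 2 * K ^+ 2)^-1 * B ->
  al / (2 * dt) * (B - B0 + Wu) + g / (2 * E) * (e + 2 * b * f) <= Q * A.
Proof.
move=> dt0 E0 g0 P0 K0 eqn low <- BG Ge young.
have Be : g / (2 * E) * (P ^+ 2 * K ^+ 2)^-1 * B <= g / (2 * E) * e.
  rewrite -[leLHS]mulrA ler_wpM2l ?divr_ge0 ?mulr_ge0 ?(ltW g0) ?(ltW E0)//.
  rewrite ler_pdivrMl ?mulr_gt0 ?exprn_gt0// (le_trans BG)//.
  rewrite -[P ^+ 2 * K ^+ 2 * e]mulrA.
  by rewrite ler_wpM2l ?sqr_ge0.
have E1 : al / (2 * dt) * (2 * s) = al / dt * s by field; rewrite gt_eqF.
have E2 : g / (2 * E) * (e + 2 * b * f) = g / E * (e + b * f) - g / (2 * E) * e.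
  by field; rewrite gt_eqF.
by rewrite E1 E2; lra.
Qed.

(** The new value [Y n] stands on the right, so a step divides by [1 - x]; for [x <= 2^-1] this
    costs at most a factor [1 + 2 * x <= expR (2 * x)]. The induction carries the dissipated sum
    along with [Y]. *)
Lemma discrete_gronwall (R : realType) (Y s : nat -> R) (x : R) (N : nat) :
  0 <= x <= 2^-1 -> 0 <= Y 0%N -> (forall n, 0 <= s n) ->
  (forall n, (1 <= n <= N)%N -> Y n - Y n.-1 + s n <= x * Y n) ->
  forall n, (n <= N)%N ->
    Y n + \sum_(1 <= i < n.+1) s i <= Y 0%N * expR (2 * x * n%:R).
Proof.
move=> /andP[x0 x2] Y0 s0 H; elim=> [_|n ih nN].
  by rewrite big_geq// addr0 mulr0 expR0 mulr1.
have {}ih := ih (ltnW nN); have := H n.+1 nN; rewrite /= => Hn.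
rewrite big_nat_recr//=; set Z := \sum_(_ <= _ < _) _ in ih *.
have Z0 : 0 <= Z by apply: sumr_ge0 => i _; exact: s0.
have -> : 2 * x * n.+1%:R = 2 * x * n%:R + 2 * x by rewrite -[n.+1%:R]natr1; ring.
rewrite expRD mulrA; have sn := s0 n.+1.
have e2 := expR_ge1Dx (2 * x).
set L := Y n.+1 + (Z + s n.+1).
have L1 : (1 - x) * L <= Y n + Z.
  have xZ : 0 <= x * (Z + s n.+1) by rewrite mulr_ge0// addr_ge0.
  have -> : (1 - x) * L = Y n.+1 + Z + s n.+1 - x * Y n.+1 - x * (Z + s n.+1).
    by rewrite /L; ring.
  by lra.
have q1 : 1 <= (1 - x) * (1 + 2 * x).
  by have : 0 <= x * (1 - 2 * x) by [rewrite mulr_ge0//; lra]; lra.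
have p0 : 0 <= Y 0%N * expR (2 * x * n%:R) by rewrite mulr_ge0// expR_ge0.
(* [Y] may be negative after time 0, and only a nonnegative [L] can be multiplied into [q1]. *)
have [L0|L0] := lerP L 0; first by rewrite (le_trans L0)// mulr_ge0// expR_ge0.
apply: (@le_trans _ _ ((1 - x) * L * (1 + 2 * x))).
  by rewrite mulrAC -[leLHS]mul1r ler_wpM2r// ltW.
apply: ler_pM => //; last exact: (le_trans L1 ih).
- by rewrite mulr_ge0 ?(ltW L0)//; lra.
- by lra.
Qed.

(** * Upper and lower estimates of the elastic form *)

Section ElasticForm.
Context {R : realType} {d : nat} {Omega : set 'rV[R]_d}.
Hypothesis oO : open Omega.
Let mO := measurable_open oO.
Local Notation point := 'rV[R]_d.
Local Notation mu := (lebesgue_rV R d).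
Context {m : material R} {l1 l2 delta : R}.
Hypotheses (delta0 : 0 <= delta) (E1_gt0 : 0 < E1 m) (E2_lt0 : E2 m < 0).
Hypotheses (small1 : 0 < 1 - `|l1| * delta)
  (small2 : 0 < gamma3 d m - `|gamma4 d m l1 l2| * delta)
  (small3 : 0 < 1 - `|l2| * delta).
Local Notation g1 := (gamma1 l1 delta).
Local Notation g2 := (gamma2 l1 delta).
Local Notation g5 := (gamma5 d m l1 l2 delta).
Local Notation g6 := (gamma6 d m l1 l2 delta).
Local Notation g7 := (gamma7 l2 delta).
Local Notation g8 := (gamma8 l2 delta).
Local Notation eps := (symgrad Omega).
Implicit Types u uo z : point -> 'rV[R]_d.

(** The elastic part of the scheme, with coefficients frozen at the old displacement [uo]. *)
Definition elastic_form uo u z : R :=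
  let tau := fun x => truncation delta (div Omega uo x) in
  (E1 m)^-1 * \int[mu]_(x in Omega)
    (frob (eps u x) (eps z x) / (1 + l1 * tau x)) +
  `|E2 m| / E1 m * \int[mu]_(x in Omega)
    ((1 + l2 * tau x) / (1 + l1 * tau x) *
     (div Omega u x * div Omega z x / Flin d m l1 l2 (tau x))).

(** The weight of the divergence is fitted to the energy balance: [g1 / (2 * E1 m)] times this
    quantity is what coercivity leaves once half of the strain term is spent. *)
Definition elastic_energy u : R :=
  L2dot Omega (eps u) (eps u) + 2 * `|E2 m| * (g5 * g7) * L2sq Omega (div Omega u).

Lemma elastic_formE uo u z : elastic_form uo u z =
  (E1 m)^-1 * \int[mu]_(x in Omega)
    (shear_coef l1 delta (div Omega uo x) * frob (eps u x) (eps z x)) +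
  `|E2 m| / E1 m * \int[mu]_(x in Omega)
    (pressure_coef d m l1 l2 delta (div Omega uo x) * (div Omega u x * div Omega z x)).
Proof.
by congr (_ * _ + _ * _); apply: eq_Rintegral => x _; [rewrite mulrC|rewrite mulrA mulrAC].
Qed.

Lemma measurable_shear uo : inH10v Omega uo ->
  measurable_fun Omega (fun x => shear_coef l1 delta (div Omega uo x)).
Proof.
move=> Huo; apply: (@measurableT_comp _ _ _ _ _ _ (shear_coef l1 delta)).
  by apply: continuous_measurable_fun; exact: continuous_shear_coef.
by have [] := inL2_div oO Huo.
Qed.

Lemma measurable_pressure uo : inH10v Omega uo ->
  measurable_fun Omega (fun x => pressure_coef d m l1 l2 delta (div Omega uo x)).
Proof.
move=> Huo; apply: (@measurableT_comp _ _ _ _ _ _ (pressure_coef d m l1 l2 delta)).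
  by apply: continuous_measurable_fun; exact: continuous_pressure_coef.
by have [] := inL2_div oO Huo.
Qed.

Let p1 : 0 < g1. Proof. exact: gamma1_gt0. Qed.
Let p2 : 0 < g2. Proof. exact: gamma2_gt0. Qed.
Let p5 : 0 < g5. Proof. exact: gamma5_gt0. Qed.
Let p6 : 0 < g6. Proof. exact: gamma6_gt0. Qed.
Let p7 : 0 < g7. Proof. exact: gamma7_gt0. Qed.
Let p8 : 0 < g8. Proof. exact: gamma8_gt0. Qed.
Let e2 : 0 < `|E2 m|. Proof. by rewrite normr_gt0 lt_eqF. Qed.

Lemma shear_coef_norm f : `|shear_coef l1 delta f| <= g2.
Proof.
have /andP[h1 h2] := shear_coef_bounds l1 _ delta0 small1 f.
by rewrite ger0_norm// (le_trans (ltW p1)).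
Qed.

Lemma pressure_coef_norm f : `|pressure_coef d m l1 l2 delta f| <= g8 * g2 * g6.
Proof.
have /andP[h1 h2] := pressure_coef_bounds _ _ _ _ _ delta0 E2_lt0 small1 small2 small3 f.
by rewrite ger0_norm// (le_trans _ h1)// ltW// !mulr_gt0.
Qed.

Lemma elastic_energy_ge0 u : 0 <= elastic_energy u.
Proof.
apply: addr_ge0; first exact: L2dot_ge0.
apply: mulr_ge0; last by apply: Rintegral_ge0 => x _; exact: sqr_ge0.
by apply/ltW/mulr_gt0; apply: mulr_gt0.
Qed.

Lemma D1_gt0 : 0 < D1 d m l1 l2 delta.
Proof. by rewrite mulr_gt0// divr_gt0 ?exprn_gt0 ?mulr_gt0. Qed.

Lemma D2_gt0 : 0 < D2 d m l1 l2 delta.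
Proof. by rewrite ltr_pwDl// divr_ge0// ltW// D1_gt0. Qed.

Lemma D3_ge0 h dt : 0 < alpha m -> 0 < dt -> 0 <= D3 d m l1 l2 delta h dt.
Proof.
move=> al0 dt0; apply: addr_ge0; first by rewrite divr_ge0 ?sqr_ge0 ?ltW.
by apply/ltW/mulr_gt0; [apply: mulr_gt0; rewrite divr_gt0 ?exprn_gt0|exact: D2_gt0].
Qed.

Lemma D4_coef_ge0 K : 0 < alpha m -> 0 <= E1 m * K ^+ 2 / (alpha m * g1).
Proof.
move=> al0; apply: divr_ge0; last by apply/ltW/mulr_gt0.
by rewrite mulr_ge0 ?sqr_ge0// ltW.
Qed.

Lemma D4_ge0 P K h dt : 0 < alpha m -> 0 < dt -> 0 <= D4 d m l1 l2 delta P K h dt.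
Proof.
move=> al0 dt0; rewrite mulr_ge0 ?sqr_ge0// addr_ge0//.
by apply: mulr_ge0; [exact: D4_coef_ge0|exact: D3_ge0].
Qed.

(* [(alpha m) ^+ 2] bounds [(alpha m * h) ^+ 2 / dt], and is its value at [h = dt = 1]. *)
Lemma D3_le_unit h dt : 0 < dt -> h ^+ 2 <= dt ->
  D3 d m l1 l2 delta h dt <= D3 d m l1 l2 delta 1 1.
Proof.
move=> dt0 hdt; rewrite lerD2r mulr1 divr1 exprMn -mulrA ler_piMr ?sqr_ge0//.
by rewrite ler_pdivrMr// mul1r.
Qed.

Lemma D4_le_unit P K h dt : 0 < alpha m -> 0 < dt -> h ^+ 2 <= dt ->
  D4 d m l1 l2 delta P K h dt <= D4 d m l1 l2 delta P K 1 1.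
Proof.
move=> al0 dt0 hdt; rewrite ler_wpM2l ?sqr_ge0// lerD2l.
by apply: ler_wpM2l; [exact: D4_coef_ge0|exact: D3_le_unit].
Qed.

(* The weights of the two Young inequalities are chosen so that their constants
   add up to [1 + D1 / 2 = D2]; this is where [D1] comes from. *)
Lemma elastic_form_upper {k uo u z} : 0 < k ->
  inH10v Omega uo -> inH10v Omega u -> inH10v Omega z ->
  - elastic_form uo u z <=
  k / 2 * (g2 / E1 m) ^+ 2 * D2 d m l1 l2 delta * elastic_energy u +
  (2 * k)^-1 * L2dot Omega (grad Omega z) (grad Omega z).
Proof.
move=> k0 Huo Hu Hz; rewrite elastic_formE.
apply: (young_absorb_pair _ _ _ _ g2 g5 g6 g7 g8 (D1 d m l1 l2 delta) _ _ _ _ _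
  (L2dot Omega (eps z) (eps z)) (L2sq Omega (div Omega z))) => // [t t0|t t0||].
- apply: weighted_young => //; [exact: measurable_shear| |exact: inL2mx_symgrad..].
  by move=> x _; exact: shear_coef_norm.
- apply: weighted_young_scalar => //; [exact: measurable_pressure| |exact: inL2_div..].
  by move=> x _; exact: pressure_coef_norm.
- exact: L2dot_symgrad_le.
- exact: L2sq_div_le.
Qed.

(** The two coefficients are replaced by their lower bounds [g1] and [g7 * g1 * g5], which share the
    factor [g1]. *)
Lemma elastic_form_lower {uo u} : inH10v Omega uo -> inH10v Omega u ->
  g1 / E1 m * (L2dot Omega (eps u) (eps u) +
    `|E2 m| * (g5 * g7) * L2sq Omega (div Omega u)) <= elastic_form uo u u.
Proof.
move=> Huo Hu; rewrite elastic_formE.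
have -> : g1 / E1 m * (L2dot Omega (eps u) (eps u) +
    `|E2 m| * (g5 * g7) * L2sq Omega (div Omega u)) =
    (E1 m)^-1 * (g1 * L2dot Omega (eps u) (eps u)) +
    `|E2 m| / E1 m * (g7 * g1 * g5 * L2sq Omega (div Omega u)).
  by move: (L2dot _ _ _) (L2sq _ _) => e f; field; rewrite gt_eqF.
apply: lerD.
  rewrite ler_wpM2l ?invr_ge0 ?(ltW E1_gt0)//.
  rewrite -RintegralZl//; last by apply: frob_integrable => //; exact: inL2mx_symgrad.
  apply: le_Rintegral => //.
  - apply: integrable_scale => //.
    by apply: frob_integrable => //; exact: inL2mx_symgrad.
  - apply: weighted_frob_integrable => //; [exact: measurable_shear| |exact: inL2mx_symgrad..].
    by move=> x _; exact: shear_coef_norm.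
  - move=> x _; rewrite ler_wpM2r ?frob_ge0//.
    by have /andP[] := shear_coef_bounds l1 _ delta0 small1 (div Omega uo x).
rewrite ler_wpM2l ?divr_ge0 ?(ltW E1_gt0)//.
have d2 := inL2_div oO Hu.
rewrite -RintegralZl//; last exact: inL2_sqr.
apply: le_Rintegral => //.
- by apply: integrable_scale => //; exact: inL2_sqr.
- have := inL2_mul mO (inL2_bounded_mul mO _ _ _ (measurable_pressure _ Huo)
    (fun x _ => pressure_coef_norm _) d2) d2.
  by apply: eq_integrable => // x _ /=; rewrite mulrA.
- move=> x _; rewrite -expr2 ler_wpM2r ?sqr_ge0//.
  by have /andP[] := pressure_coef_bounds d _ _ _ _ delta0 E2_lt0 small1 small2 small3
    (div Omega uo x).
Qed.
End ElasticForm.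

(** * One step of the fully discrete scheme *)

Lemma L2norm_le_sqr {R : realType} {d m n m' n' : nat} {Omega : set 'rV[R]_d}
    {A : 'rV[R]_d -> 'M[R]_(m, n)} {B : 'rV[R]_d -> 'M[R]_(m', n')} {c : R} :
  L2norm Omega A <= c * L2norm Omega B ->
  L2dot Omega A A <= c ^+ 2 * L2dot Omega B B.
Proof.
move=> AB; have A0 : 0 <= L2norm Omega A := sqrtr_ge0 _.
by rewrite -!L2norm_sqr -exprMn ler_pXn2r ?nnegrE// (le_trans A0).
Qed.

Section SchemeStep.
Context {R : realType} {d : nat} {Omega : set 'rV[R]_d}.
Hypothesis oO : open Omega.
Let mO := measurable_open oO.
Context {T : R} {m : material R} {u0 v0 : 'rV[R]_d -> 'rV[R]_d}.
Context {l1 l2 delta P K C beta h : R} {S : discretization R d}.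
Hypotheses (T0 : 0 < T) (hm : admissible_material d m) (delta0 : 0 <= delta).
Hypotheses (hu0 : inH10v Omega u0) (hv0 : inV Omega v0).
Hypotheses (P0 : 0 < P) (K0 : 0 < K) (C0 : 0 < C) (h0 : 0 < h).
Hypotheses (hP : poincare_constant Omega P) (hK : korn_constant Omega K).
Hypothesis hS : admissible_discretization Omega C beta h S.
Hypotheses (small1 : 0 < 1 - `|l1| * delta)
  (small2 : 0 < gamma3 d m - `|gamma4 d m l1 l2| * delta)
  (small3 : 0 < 1 - `|l2| * delta).
Context {N : nat} {u v : nat -> 'rV[R]_d -> 'rV[R]_d} {p : nat -> 'rV[R]_d -> R}.
Hypothesis hN : (0 < N)%N.
Hypothesis hsol : scheme_solution Omega m l1 l2 delta T u0 v0 S N u v p.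
Let dt := T / N%:R.
Local Notation sq A := (L2dot Omega A A).
Local Notation grad := (grad Omega).
Local Notation symgrad := (symgrad Omega).

(** [scheme_spaces] starts at [n = 1]; the initial displacement belongs to the space as an
    interpolant. *)
Lemma scheme_uU {n} : (n <= N)%N -> Uh S (u n).
Proof.
case: n => [_|n nN]; last by have [] := scheme_spaces hsol (n := n.+1) nN.
by rewrite (scheme_u0 hsol); have [] := piU_spec hS hu0.
Qed.

Lemma scheme_vV {n} : (n <= N)%N -> Vh Omega S (v n).
Proof.
case: n => [_|n nN]; last by have [] := scheme_spaces hsol (n := n.+1) nN.
by rewrite (scheme_v0 hsol); have [] := piV_spec hS hv0.
Qed.

Lemma scheme_uH {n} : (n <= N)%N -> inH10v Omega (u n).
Proof. by move=> /scheme_uU; exact: Uh_H10 hS _. Qed.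

Lemma scheme_vH {n} : (n <= N)%N -> inH10v Omega (v n).
Proof. by move=> /scheme_vV[vX _]; exact: Xh_H10 hS _ vX. Qed.

Lemma dt_gt0 : 0 < dt.
Proof. by rewrite divr_gt0// ltr0n. Qed.

Let al0 : 0 < alpha m. Proof. by have [[]] := hm. Qed.
Let nu0 : 0 < nu m. Proof. by have [[]] := hm. Qed.
Let rho0 : 0 < rho m. Proof. by have [[]] := hm. Qed.
Let E10 : 0 < E1 m. Proof. by have [_ []] := hm. Qed.
Let E20 : E2 m < 0. Proof. by have [_ []] := hm. Qed.
Let g1 : 0 < gamma1 l1 delta. Proof. exact: gamma1_gt0. Qed.

Lemma elasticity_test {n z} : (1 <= n <= N)%N -> Uh S z ->
  alpha m / dt * L2dot Omega (fun x => u n x - u n.-1 x) z +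
  elastic_form (Omega := Omega) (m := m) (l1 := l1) (l2 := l2) (delta := delta)
    (u n.-1) (u n) z = alpha m * L2dot Omega (v n) z.
Proof.
by move=> nN Uz; have := scheme_elasticity hsol nN Uz; rewrite /= -addrA.
Qed.

(** The test function [v n] lies in [Vh], so the pressure [p n], an element of [Qh], drops out. *)
Lemma flow_test {n} : (1 <= n <= N)%N ->
  rho m / (2 * dt) * (sq (v n) - sq (v n.-1) + sq (fun x => v n x - v n.-1 x)) +
  nu m * sq (grad (v n)) + alpha m * sq (v n) =
  alpha m / dt * L2dot Omega (fun x => u n x - u n.-1 x) (v n).
Proof.
move=> /andP[n1 nN]; have nN' : (n.-1 <= N)%N := leq_trans (leq_pred n) nN.
have nn : (1 <= n <= N)%N by rewrite n1.
have [vX vdiv] := scheme_vV nN; have [_ _ pQ] := scheme_spaces hsol nn.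
have := scheme_flow hsol nn vX; rewrite /= (vdiv _ pQ) subr0 => <-.
congr (_ + _ + _).
rewrite -L2dot_subl2//; [|exact/(inH10v_inL2mx)/scheme_vH..].
by rewrite -/dt; field; rewrite gt_eqF// dt_gt0.
Qed.

Lemma elasticity_energy {n} : (1 <= n <= N)%N ->
  alpha m / (2 * dt) * (sq (u n) - sq (u n.-1) + sq (fun x => u n x - u n.-1 x)) +
  gamma1 l1 delta / (2 * E1 m) *
    elastic_energy (Omega := Omega) (m := m) (l1 := l1) (l2 := l2) (delta := delta) (u n) <=
  (alpha m * P * K) ^+ 2 * E1 m / (2 * gamma1 l1 delta) * sq (v n).
Proof.
move=> nn; have /andP[n1 nN] := nn.
have nN' : (n.-1 <= N)%N := leq_trans (leq_pred n) nN.
have uH := scheme_uH nN; have uH' := scheme_uH nN'.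
have uL := inH10v_inL2mx uH; have uL' := inH10v_inL2mx uH'.
have vL := inH10v_inL2mx (scheme_vH nN).
have eqn := elasticity_test nn (scheme_uU nN).
have low := elastic_form_lower oO delta0 E10 E20 small1 small2 small3 uH' uH.
have dt0 := dt_gt0.
(* Young's inequality with this [q] leaves [sq (u n)] with the weight [gamma1 / (2 * E1)] divided by
   [(P * K) ^+ 2], which half of the strain term absorbs. *)
pose q := (alpha m * P * K) ^+ 2 * E1 m / (2 * gamma1 l1 delta).
have q0 : 0 < q by rewrite divr_gt0 ?mulr_gt0 ?exprn_gt0 ?mulr_gt0.
have young : alpha m * `|L2dot Omega (v n) (u n)| <=
    q * sq (v n) + (alpha m * 1) ^+ 2 / (4 * q) * sq (u n).
  by apply: young_absorb => // t t0; rewrite mul1r; exact: L2dot_young.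
rewrite /elastic_energy -[2 * `|E2 m| * _]mulrA.
apply: (elastic_energy_balance dt0 E10 g1 P0 K0 eqn low (L2dot_subl2 mO _ _ uL uL')
  (L2norm_le_sqr (hP _ uH)) (L2norm_le_sqr (hK _ uH))).
have <- : (alpha m * 1) ^+ 2 / (4 * q) =
    gamma1 l1 delta / (2 * E1 m) * (P ^+ 2 * K ^+ 2)^-1.
  by rewrite /q; field; rewrite !gt_eqF.
by apply: le_trans young; rewrite ler_wpM2l ?(ltW al0)// ler_norm.
Qed.

(** The value of [k] for which [C ^+ 2 / (2 * k)] is [nu / 6]: three remainders of this size take
    half of the viscous term. *)
Let k := 3 * C ^+ 2 / nu m.
Let k0 : 0 < k. Proof. by rewrite divr_gt0 ?mulr_gt0 ?exprn_gt0. Qed.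

Lemma absorb_gradient {X G : R} : X <= C ^+ 2 * G -> (2 * k)^-1 * X <= nu m / 6 * G.
Proof.
move=> XG; have -> : nu m / 6 * G = (2 * k)^-1 * (C ^+ 2 * G).
  by rewrite /k; field; rewrite !gt_eqF.
by rewrite ler_wpM2l// invr_ge0 ltW// mulr_gt0.
Qed.

Lemma scheme_step {n} : (1 <= n <= N)%N ->
  sq (v n) - sq (v n.-1) +
  k / rho m * D3 d m l1 l2 delta h dt * (sq (u n) - sq (u n.-1)) +
  (sq (fun x => v n x - v n.-1 x) + nu m / rho m * (dt * sq (grad (v n))) +
   2 * alpha m / rho m * (dt * sq (v n))) <=
  k / rho m * D4 d m l1 l2 delta P K h dt * dt * sq (v n).
Proof.
move=> nn; have /andP[n1 nN] := nn.
have nN' : (n.-1 <= N)%N := leq_trans (leq_pred n) nN.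
have uH := scheme_uH nN; have uH' := scheme_uH nN'.
have uL := inH10v_inL2mx uH; have uL' := inH10v_inL2mx uH'.
have vH := scheme_vH nN; have vL := inH10v_inL2mx vH.
have dt0 := dt_gt0.
(* [v n] lies in [Xh] and need not be admissible in the elasticity equation; its interpolant in [Uh]
   is. *)
pose z := piU S (v n).
have [zU [/L2norm_le_sqr zG /L2norm_le_sqr zI]] := piU_spec hS vH.
have zH := Uh_H10 hS zU; have zL := inH10v_inL2mx zH.
have duL := inL2mx_sub mO uL uL'; have vzL := inL2mx_sub mO vL zL.
pose s1 := L2dot Omega (fun x => u n x - u n.-1 x) (fun x => v n x - z x).
pose s2 := L2dot Omega (fun x => u n x - u n.-1 x) z.
have S12 : L2dot Omega (fun x => u n x - u n.-1 x) (v n) = s1 + s2.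
  by rewrite /s1 /s2 !(L2dotC (fun x => u n x - u n.-1 x)) (L2dotBl mO)// subrK.
have flow := flow_test nn; rewrite S12 in flow.
(* The [h ^- 2] that the weight [q] leaves on the remainder cancels against the squared
   interpolation error. *)
have H1 : alpha m / dt * s1 <=
    k / 2 * (alpha m * h / dt) ^+ 2 * sq (fun x => u n x - u n.-1 x) +
    nu m / 6 * sq (grad (v n)).
  pose q := k / 2 * (alpha m * h / dt) ^+ 2.
  have q0 : 0 < q.
    by apply: mulr_gt0; [exact: divr_gt0|rewrite exprn_gt0// divr_gt0// mulr_gt0].
  have ad : 0 < alpha m / dt by rewrite divr_gt0.
  have Y : alpha m / dt * `|s1| <= q * sq (fun x => u n x - u n.-1 x) +
      (alpha m / dt * 1) ^+ 2 / (4 * q) * sq (fun x => v n x - z x).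
    by apply: young_absorb => // t t0; rewrite mul1r; exact: L2dot_young.
  apply: le_trans (le_trans Y _).
    by rewrite ler_wpM2l ?(ltW ad)// ler_norm.
  rewrite lerD2l.
  have -> : (alpha m / dt * 1) ^+ 2 / (4 * q) * sq (fun x => v n x - z x) =
      (2 * k)^-1 * (h ^- 2 * sq (fun x => v n x - z x)).
    by rewrite /q; move: (L2dot _ _ _) => X; field; rewrite !gt_eqF.
  apply: absorb_gradient; rewrite ler_pdivrMl ?exprn_gt0//.
  by rewrite mulrA -exprMn (mulrC h).
(* Here Poincaré for [z] cancels the [P ^- 2], and the gradient bound of the interpolation brings
   back the gradient of [v n]. *)
have H2 : alpha m * L2dot Omega (v n) z <=
    k / 2 * (alpha m * P) ^+ 2 * sq (v n) + nu m / 6 * sq (grad (v n)).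
  pose q := k / 2 * (alpha m * P) ^+ 2.
  have q0 : 0 < q.
    by apply: mulr_gt0; [exact: divr_gt0|rewrite exprn_gt0// mulr_gt0].
  have Y : alpha m * `|L2dot Omega (v n) z| <= q * sq (v n) +
      (alpha m * 1) ^+ 2 / (4 * q) * sq z.
    by apply: young_absorb => // t t0; rewrite mul1r; exact: L2dot_young.
  apply: le_trans (le_trans Y _).
    by rewrite ler_wpM2l ?(ltW al0)// ler_norm.
  rewrite lerD2l.
  have -> : (alpha m * 1) ^+ 2 / (4 * q) * sq z = (2 * k)^-1 * (P ^- 2 * sq z).
    by rewrite /q; move: (L2dot _ _ _) => X; field; rewrite !gt_eqF.
  apply: absorb_gradient; rewrite ler_pdivrMl ?exprn_gt0//.
  apply: (le_trans (L2norm_le_sqr (hP _ zH))).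
  by rewrite ler_wpM2l ?sqr_ge0.
have H3 := elastic_form_upper oO delta0 E10 E20 small1 small2 small3 k0 uH' uH zH.
have {}H3 := le_trans H3 (lerD (lexx _) (absorb_gradient zG)).
apply: (energy_step
  al0 nu0 rho0 E10 g1 _ dt0 k0 _ _ H1 H2 H3 flow (elasticity_test nn zU)
  (elasticity_energy nn) erefl erefl).
- exact: D2_gt0.
- exact: L2dot_ge0.
- exact: elastic_energy_ge0.
Qed.
End SchemeStep.

(** * Summation in time and uniformity of the constants *)

(** The interpolation bounds control the L2 size of the interpolant through the error, so it is
    written as [w - (w - piw)]. *)
Lemma interpolation_L2dot_le {R : realType} {d : nat} {Omega : set 'rV[R]_d}
    {C h : R} {w piw : 'rV[R]_d -> 'rV[R]_d} : open Omega ->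
  inH10v Omega w -> inH10v Omega piw -> interpolation_bounds Omega C h w piw ->
  L2dot Omega piw piw <= 2 * (L2dot Omega w w +
    C ^+ 2 * h ^+ 2 * L2dot Omega (grad Omega w) (grad Omega w)).
Proof.
move=> oO wH pH [_ /L2norm_le_sqr err]; have mO := measurable_open oO.
have wL := inH10v_inL2mx wH; have pL := inH10v_inL2mx pH.
have := L2dot_sub_le mO _ _ wL (inL2mx_sub mO wL pL).
under [X in L2dot _ X]eq_fun do rewrite subKr.
under [X in L2dot _ _ X]eq_fun do rewrite subKr.
by move=> /le_trans; apply; rewrite ler_pM2l// lerD2l -exprMn.
Qed.

(** Adding the nonnegative [x * (mu * b)] on the right puts a step into Gronwall form for the single
    quantity [a + mu * b]. *)
Lemma gronwall_step {R : realDomainType} {a a' b b' mu s x : R} : 0 <= x -> 0 <= mu ->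
  0 <= b -> a - a' + mu * (b - b') + s <= x * a ->
  a + mu * b - (a' + mu * b') + s <= x * (a + mu * b).
Proof.
move=> x0 mu0 b0; have : 0 <= x * (mu * b) by rewrite !mulr_ge0.
by lra.
Qed.

Section Stability.
Context {R : realType} {d : nat} {Omega : set 'rV[R]_d}.
Hypothesis oO : open Omega.
Context {T : R} {m : material R} {u0 v0 : 'rV[R]_d -> 'rV[R]_d}.
Context {l1 l2 delta P K C beta h : R} {S : discretization R d}.
Hypotheses (T0 : 0 < T) (hm : admissible_material d m) (delta0 : 0 <= delta).
Hypotheses (hu0 : inH10v Omega u0) (hv0 : inV Omega v0).
Hypotheses (P0 : 0 < P) (K0 : 0 < K) (C0 : 0 < C) (h0 : 0 < h).
Hypotheses (hP : poincare_constant Omega P) (hK : korn_constant Omega K).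
Hypothesis hS : admissible_discretization Omega C beta h S.
Hypotheses (small1 : 0 < 1 - `|l1| * delta)
  (small2 : 0 < gamma3 d m - `|gamma4 d m l1 l2| * delta)
  (small3 : 0 < 1 - `|l2| * delta).
Context {N : nat} {u v : nat -> 'rV[R]_d -> 'rV[R]_d} {p : nat -> 'rV[R]_d -> R}.
Hypothesis hN : (0 < N)%N.
Hypothesis hsol : scheme_solution Omega m l1 l2 delta T u0 v0 S N u v p.
Let dt := T / N%:R.
Local Notation sq A := (L2dot Omega A A).
Local Notation D3h := (D3 d m l1 l2 delta).
Local Notation D4h := (D4 d m l1 l2 delta P K).

Let dt0 : 0 < dt. Proof. by rewrite divr_gt0// ltr0n. Qed.
Let al0 : 0 < alpha m. Proof. by have [[]] := hm. Qed.
Let nu0 : 0 < nu m. Proof. by have [[]] := hm. Qed.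
Let rho0 : 0 < rho m. Proof. by have [[]] := hm. Qed.
Let E10 : 0 < E1 m. Proof. by have [_ []] := hm. Qed.
Let E20 : E2 m < 0. Proof. by have [_ []] := hm. Qed.

Lemma scheme_stability {n} : (n <= N)%N ->
  6 * C ^+ 2 * D4h h dt / (nu m * rho m) * dt <= 1 ->
  sq (v n) + \sum_(1 <= i < n) sq (fun x => v i x - v i.-1 x) +
  nu m / rho m * \sum_(1 <= i < n.+1) dt * sq (grad Omega (v i)) +
  2 * alpha m / rho m * \sum_(1 <= i < n.+1) dt * sq (v i)
  <= (sq (v 0%N) + 3 * C ^+ 2 * D3h h dt / (nu m * rho m) * sq (u 0%N)) *
     expR (9 * C ^+ 2 * D4h h dt / (nu m * rho m) * (n%:R * dt)).
Proof.
move=> nN step_small.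
have D30 : 0 <= D3h h dt by exact: D3_ge0.
have D40 : 0 <= D4h h dt by exact: D4_ge0.
pose mu := 3 * C ^+ 2 * D3h h dt / (nu m * rho m).
have mu0 : 0 <= mu by rewrite divr_ge0 ?mulr_ge0 ?sqr_ge0// ltW.
(* The time step condition reads [2 * x <= 1], which is the range of [discrete_gronwall]. *)
pose x := 3 * C ^+ 2 * D4h h dt / (nu m * rho m) * dt.
have x0 : 0 <= x.
  apply: mulr_ge0; last exact: ltW.
  apply: divr_ge0; last by apply/ltW/mulr_gt0.
  by apply: mulr_ge0 => //; rewrite mulr_ge0 ?sqr_ge0.
have x2 : x <= 2^-1.
  move: step_small; have -> : 6 * C ^+ 2 * D4h h dt / (nu m * rho m) * dt = 2 * x.
    by rewrite /x; field; rewrite !gt_eqF.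
  by lra.
(* At [n = 0] this is the constant in front of the exponential. *)
pose Y n := sq (v n) + mu * sq (u n).
pose s n := sq (fun x => v n x - v n.-1 x) +
  nu m / rho m * (dt * sq (grad Omega (v n))) + 2 * alpha m / rho m * (dt * sq (v n)).
have Y0 : 0 <= Y 0%N.
  apply: addr_ge0; first exact: L2dot_ge0.
  by apply: mulr_ge0 => //; exact: L2dot_ge0.
have s0 i : 0 <= s i.
  have c1 : 0 <= nu m / rho m by rewrite divr_ge0// ltW.
  have c2 : 0 <= 2 * alpha m / rho m by rewrite divr_ge0 ?mulr_ge0// ltW.
  have dtsq m1 m2 (A : _ -> 'M[R]_(m1, m2)) : 0 <= dt * sq A.
    by rewrite mulr_ge0 ?L2dot_ge0// ltW.
  by apply: addr_ge0; [apply: addr_ge0; [exact: L2dot_ge0|]|]; exact: mulr_ge0.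
have step i : (1 <= i <= N)%N -> Y i - Y i.-1 + s i <= x * Y i.
  move=> iN; have := scheme_step oO T0 hm delta0 hu0 hv0 P0 K0 C0 h0 hP hK hS
    small1 small2 small3 hN hsol iN.
  have -> : 3 * C ^+ 2 / nu m / rho m * D3 d m l1 l2 delta h (T / N%:R) = mu.
    by rewrite /mu -/dt; field; rewrite !gt_eqF.
  have -> : 3 * C ^+ 2 / nu m / rho m * D4 d m l1 l2 delta P K h (T / N%:R) *
      (T / N%:R) = x.
    by rewrite /x -/dt; field; rewrite !gt_eqF.
  by apply: gronwall_step => //; exact: L2dot_ge0.
have xb : 0 <= x <= 2^-1 by rewrite x0.
have gron := discrete_gronwall _ Y s x N xb Y0 s0 step n nN.
have sumE : \sum_(1 <= i < n.+1) s i = \sum_(1 <= i < n.+1) sq (fun x => v i x - v i.-1 x) +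
    nu m / rho m * \sum_(1 <= i < n.+1) dt * sq (grad Omega (v i)) +
    2 * alpha m / rho m * \sum_(1 <= i < n.+1) dt * sq (v i).
  by rewrite !big_split/= -!mulr_sumr.
(* The claim drops [mu * sq (u n)] and the last velocity increment, since its sum of increments
   stops at [n - 1]. *)
apply: (@le_trans _ _ (Y n + \sum_(1 <= i < n.+1) s i)).
  rewrite sumE !addrA lerD2r lerD2r; apply: lerD.
    by rewrite lerDl; apply: mulr_ge0 => //; exact: L2dot_ge0.
  case: n {nN gron sumE} => [|n]; first by rewrite !big_geq.
  by rewrite [leRHS]big_nat_recr//= lerDl L2dot_ge0.
apply: (le_trans gron); apply: ler_wpM2l => //.
rewrite ler_expR.
(* Gronwall gives the exponent [2 * x * n]; the 9 of the claim amounts to the weaker [3 * x * n]. *)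
have -> : 9 * C ^+ 2 * D4h h dt / (nu m * rho m) * (n%:R * dt) = 3 * x * n%:R.
  by rewrite /x; field; rewrite !gt_eqF.
by rewrite ler_wpM2r// ler_wpM2r// ler_nat.
Qed.

(** [h ^+ 2 <= dt <= T] replaces [h ^+ 2] by [T] in the interpolation bounds for the initial data,
    while [D3] and [D4] are bounded by their values at [h = dt = 1]. *)
Lemma stability_constants_le : h ^+ 2 <= dt ->
  sq (v 0%N) + 3 * C ^+ 2 * D3h h dt / (nu m * rho m) * sq (u 0%N) <=
    2 * (sq v0 + C ^+ 2 * T * sq (grad Omega v0)) +
    3 * C ^+ 2 * D3h 1 1 / (nu m * rho m) *
      (2 * (sq u0 + C ^+ 2 * T * sq (grad Omega u0))) /\
  9 * C ^+ 2 * D4h h dt / (nu m * rho m) <= 9 * C ^+ 2 * D4h 1 1 / (nu m * rho m).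
Proof.
move=> hdt.
have hT : h ^+ 2 <= T.
  by rewrite (le_trans hdt)// ler_pdivrMr ?ltr0n// ler_peMr ?ler1n// ltW.
have [_ vI] := piV_spec hS hv0; have [_ uI] := piU_spec hS hu0.
rewrite -(scheme_v0 hsol) in vI; rewrite -(scheme_u0 hsol) in uI.
have vle := interpolation_L2dot_le oO hv0.1 (scheme_vH hv0 hS hsol (leq0n N)) vI.
have ule := interpolation_L2dot_le oO hu0 (scheme_uH hu0 hS hsol (leq0n N)) uI.
have enlarge (w : 'rV[R]_d -> 'rV[R]_d) :
    2 * (sq w + C ^+ 2 * h ^+ 2 * sq (grad Omega w)) <=
    2 * (sq w + C ^+ 2 * T * sq (grad Omega w)).
  rewrite ler_pM2l// lerD2l; apply: ler_wpM2r; first exact: L2dot_ge0.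
  by rewrite ler_wpM2l// sqr_ge0.
have nr0 : 0 <= (nu m * rho m)^-1 by rewrite invr_ge0 ltW// mulr_gt0.
have C20 n : 0 <= n%:R * C ^+ 2 by rewrite mulr_ge0 ?sqr_ge0.
have D30 : 0 <= D3h h dt by exact: D3_ge0.
split; last first.
  apply: ler_wpM2r => //; apply: ler_wpM2l; first exact: C20.
  exact: D4_le_unit.
apply: lerD; first exact: le_trans vle (enlarge _).
apply: ler_pM.
- by apply: mulr_ge0 => //; apply: mulr_ge0.
- exact: L2dot_ge0.
- apply: ler_wpM2r => //; apply: ler_wpM2l; first exact: C20.
  exact: D3_le_unit.
- exact: le_trans ule (enlarge _).
Qed.
End Stability.

(** * The stability estimate in terms of norms, and one bound for both constants *)

Theorem theorem1 (R : realType) (d : nat) (hd : d = 2%N \/ d = 3%N)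
    (Omega : set 'rV[R]_d) (hOmega : lipschitz_polytopal_domain Omega)
    (T : R) (hT : 0 < T)
    (m : material R) (hm : admissible_material d m)
    (u0 v0 : 'rV[R]_d -> 'rV[R]_d) (hu0 : inH10v Omega u0) (hv0 : inV Omega v0)
    (lambdabar D : R) (hlambdabar : 0 < lambdabar) (hD : 0 < D)
    (hsol : forall l1 l2 : R, `|l1| <= lambdabar -> `|l2| <= lambdabar ->
      has_regular_solution Omega T m l1 l2 u0 v0 D)
    (delta : R) (hdelta : D <= delta)
    (P K : R) (hP0 : 0 < P) (hK0 : 0 < K)
    (hP : poincare_constant Omega P) (hK : korn_constant Omega K)
    (meshsizes : set R) (S : R -> discretization R d) (C betastar : R)
    (hC : 0 < C) (hbeta : 0 < betastar)
    (hS : forall h, meshsizes h ->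
      0 < h /\ admissible_discretization Omega C betastar h (S h))
    (l1 l2 : R) (hl1 : `|l1| <= lambdabar) (hl2 : `|l2| <= lambdabar)
    (hsmall1 : 0 < 1 - `|l1| * delta)
    (hsmall2 : 0 < gamma3 d m - `|gamma4 d m l1 l2| * delta)
    (hsmall3 : 0 < 1 - `|l2| * delta) :
  let D3h := D3 d m l1 l2 delta in
  let D4h := D4 d m l1 l2 delta P K in
  let C1 := fun h dt (uh0 vh0 : 'rV[R]_d -> 'rV[R]_d) =>
    L2norm Omega vh0 ^+ 2 +
    3 * C ^+ 2 * D3h h dt / (nu m * rho m) * L2norm Omega uh0 ^+ 2 in
  let C2 := fun h dt => 9 * C ^+ 2 * D4h h dt / (nu m * rho m) in
  (forall (h : R) (N : nat) (u v : nat -> 'rV[R]_d -> 'rV[R]_d)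
      (p : nat -> 'rV[R]_d -> R),
    meshsizes h -> (1 < N)%N ->
    scheme_solution Omega m l1 l2 delta T u0 v0 (S h) N u v p ->
    let dt := T / N%:R in
    6 * C ^+ 2 * D4h h dt / (nu m * rho m) * dt <= 1 ->
    forall n : nat, (1 <= n <= N)%N ->
      L2norm Omega (v n) ^+ 2 +
      \sum_(1 <= i < n) L2norm Omega (fun x => v i x - v i.-1 x) ^+ 2 +
      nu m / rho m *
        \sum_(1 <= i < n.+1) dt * L2norm Omega (grad Omega (v i)) ^+ 2 +
      2 * alpha m / rho m *
        \sum_(1 <= i < n.+1) dt * L2norm Omega (v i) ^+ 2
      <= C1 h dt (u 0%N) (v 0%N) * expR (C2 h dt * (n%:R * dt)))
  /\
  (exists M : R, forall (h : R) (N : nat) (u v : nat -> 'rV[R]_d -> 'rV[R]_d)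
      (p : nat -> 'rV[R]_d -> R),
    meshsizes h -> (1 < N)%N ->
    scheme_solution Omega m l1 l2 delta T u0 v0 (S h) N u v p ->
    let dt := T / N%:R in
    6 * C ^+ 2 * D4h h dt / (nu m * rho m) * dt <= 1 ->
    h ^+ 2 <= dt ->
    C1 h dt (u 0%N) (v 0%N) <= M /\ C2 h dt <= M).
Proof.
move=> D3h D4h C1 C2.
have oO : open Omega by have [[]] := hOmega.
have delta0 : 0 <= delta by rewrite (le_trans (ltW hD)).
split.
  move=> h N u v p hh N1 hsolh dt small n /andP[n1 nN]; have [h0 hSh] := hS h hh.
  have N0 := ltnW N1.
  have := scheme_stability oO hT hm delta0 hu0 hv0 hP0 hK0 hC h0 hP hK hSh
    hsmall1 hsmall2 hsmall3 N0 hsolh nN small.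
  have sumE k1 k2 m1 m2 (c : R) (A : nat -> 'rV[R]_d -> 'M[R]_(m1, m2)) :
      \sum_(k1 <= i < k2) c * L2norm Omega (A i) ^+ 2 =
      \sum_(k1 <= i < k2) c * L2dot Omega (A i) (A i).
    by apply: eq_bigr => i _; rewrite L2norm_sqr.
  have sumE1 : \sum_(1 <= i < n) L2norm Omega (fun x => v i x - v i.-1 x) ^+ 2 =
      \sum_(1 <= i < n) L2dot Omega (fun x => v i x - v i.-1 x)
        (fun x => v i x - v i.-1 x).
    by apply: eq_bigr => i _; rewrite L2norm_sqr.
  by rewrite /C1 /C2 !sumE sumE1 !L2norm_sqr.
pose sq k1 k2 (A : 'rV[R]_d -> 'M[R]_(k1, k2)) := L2dot Omega A A.
(* [M1] and [M2] are built from the data and the fixed constants alone, before [h] and [N] are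
   chosen; their maximum serves [C1] and [C2] at once. *)
pose M1 := 2 * (sq _ _ v0 + C ^+ 2 * T * sq _ _ (grad Omega v0)) +
    3 * C ^+ 2 * D3h 1 1 / (nu m * rho m) *
      (2 * (sq _ _ u0 + C ^+ 2 * T * sq _ _ (grad Omega u0))).
pose M2 := 9 * C ^+ 2 * D4h 1 1 / (nu m * rho m).
exists (Num.max M1 M2) => h N u v p hh N1 hsolh dt small hdt.
have [h0 hSh] := hS h hh; have N0 := ltnW N1.
have [b1 b2] := stability_constants_le oO hT hm delta0 hu0 hv0 (P := P) (K := K) hSh
  hsmall1 hsmall2 hsmall3 N0 hsolh hdt.
by rewrite /C1 /C2 !L2norm_sqr; split; rewrite le_max ?b1 ?b2 ?orbT.
Qed.
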